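(* Let $H^{\mathrm{bulk}}$ satisfy the short-range assumption with constants $d,K_d$ and the bulk-gap assumption with constant $\Delta$, let $H=\iota^*H^{\mathrm{bulk}}\iota$ be its restriction to the open chain of length $L$, and set $$\delta=\sqrt{\frac{128\,\Delta\, d\, K_d}{L}},\qquad S=\tanh(H/\delta).$$ Then each of the two quantities $\mathcal I_{\mathrm{bulk}}=\tfrac12\operatorname{Tr}\big(CS[\theta(X),S]\big)$ and $\mathcal I_{\mathrm{edge}}=\operatorname{Tr}\big(C\theta(X)(1-S^2)\big)$ satisfies $$\mathcal I_{\mathrm{edge/bulk}}\in\mathbb Z+\gamma\, e^{-\sqrt{\frac{L\Delta}{128\, d\,K_d}}},$$ i.e. there is an integer $n$ with $|\mathcal I_{\mathrm{edge/bulk}}-n|\le|\gamma|\,e^{-\sqrt{L\Delta/(128 dK_d)}}$, where $|\gamma|$ is bounded by a polynomial function of the variables $(K_d,d,L)$.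
   Context: Let $L\in\mathbb N$, $\mathcal H_L=\ell^2(\{0,\dots,L-1\})\otimes\mathbb C^2$ with canonical basis $|x,s\rangle$, $x\in\{0,\dots,L-1\}$, $s\in\{A,B\}$, and $\mathcal H^{\mathrm{bulk}}=\ell^2(\mathbb Z)\otimes\mathbb C^2$. Let $\iota:\mathcal H_L\to\mathcal H^{\mathrm{bulk}}$ be extension by zero and $\iota^*$ the restriction to sites $\{0,\dots,L-1\}$. The chiral operator is $C=\begin{pmatrix}\mathbb 1_A&0\\0&-\mathbb 1_B\end{pmatrix}$, i.e. $C|x,A\rangle=|x,A\rangle$, $C|x,B\rangle=-|x,B\rangle$ (on either space). $H^{\mathrm{bulk}}$ is a bounded self-adjoint operator on $\mathcal H^{\mathrm{bulk}}$ with $H^{\mathrm{bulk}}C+CH^{\mathrm{bulk}}=0$, and $H=\iota^*H^{\mathrm{bulk}}\iota$ (a Hermitian $2L\times2L$ matrix with $HC+CH=0$). For an operator $T$, $T_{x,y}$ denotes its $2\times2$ matrix block between sites $x$ and $y$, and $\|\cdot\|$ is the operator norm. Short-range assumption: there exist $d>0$ and $K_d>0$ with $\sup_{x\in\mathbb Z}\sum_{x'\in\mathbb Z}\|H^{\mathrm{bulk}}_{x,x'}\|e^{|x-x'|/d}\le K_d$. Bulk-gap assumption: there exists $\Delta>0$ with $\operatorname{Spec}(H^{\mathrm{bulk}})\cap(-\Delta,\Delta)=\emptyset$. The switch function is $\theta:\{0,\dots,L-1\}\to\mathbb R$, $\theta(x)=1$ for $x<\lfloor L/2\rfloor$ and $\theta(x)=0$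 otherwise (equal to 1 near the left edge, 0 near the right edge, jumping in the middle of the chain), and $\theta(X)$ is the multiplication operator $(\theta(X)\psi)_x=\theta(x)\psi_x$. *)

(* Defs.v *)
From HB Require Import structures.
From mathcomp Require Import all_boot all_order all_algebra.
From mathcomp Require Import all_classical all_reals all_analysis.
From mathcomp Require Import complex.
From mathcomp Require mpoly.

Set Implicit Arguments.
Unset Strict Implicit.
Unset Printing Implicit Defensive.

Import Order.TTheory GRing.Theory Num.Theory.
Local Open Scope ring_scope.

Section Defs.
Variable R : realType.

Definition cabs2 (z : R[i]) : R := (@complex.Re R z) ^+ 2 + (@complex.Im R z) ^+ 2.
Definition cabs (z : R[i]) : R := Num.sqrt (cabs2 z).

Definition mxstar m n (A : 'M[R[i]]_(m, n)) : 'M[R[i]]_(n, m) :=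
  map_mx (@conjc R) A^T.

Definition vnorm2 n (v : 'cV[R[i]]_n) : R := \sum_i cabs2 (v i ord0).

Definition opnorm m n (A : 'M[R[i]]_(m, n)) : R :=
  sup [set Num.sqrt (vnorm2 (A *m v)) | v in [set v : 'cV[R[i]]_n | vnorm2 v = 1]].

(* ---------- bulk operator on l^2(Z) (x) C^2, given by its 2x2 block kernel ------- *)
(* h x y is the 2x2 block H^bulk_{x,y}; basis of C^2 is (A, B) = (0, 1). *)
Definition bulk_kernel := int -> int -> 'M[R[i]]_2.

Definition chiral2 : 'M[R[i]]_2 := diag_mx (\row_(i < 2) (if i == ord0 then 1 else -1)).

Definition bulk_selfadjoint (h : bulk_kernel) : Prop :=
  forall x y, h y x = mxstar (h x y).

(* H C + C H = 0 (C is block diagonal, so this is blockwise) *)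
Definition bulk_chiral (h : bulk_kernel) : Prop :=
  forall x y, chiral2 *m h x y + h x y *m chiral2 = 0.

(* finitely supported vectors: psi restricted to the finite support s *)
Definition restr (s : seq int) (psi : int -> 'cV[R[i]]_2) (x : int) : 'cV[R[i]]_2 :=
  if x \in s then psi x else 0.
Definition fsnorm2 (s : seq int) (psi : int -> 'cV[R[i]]_2) : R :=
  \sum_(y <- undup s) vnorm2 (psi y).
Definition bulk_apply (h : bulk_kernel) (s : seq int) (psi : int -> 'cV[R[i]]_2)
  (x : int) : 'cV[R[i]]_2 :=
  \sum_(y <- undup s) h x y *m psi y.
Definition l2norm2 (phi : int -> 'cV[R[i]]_2) : \bar R :=
  (\esum_(x in [set: int]) (vnorm2 (phi x))%:E)%E.

(* H^bulk is bounded on l^2 (checked on the dense subspace of finitely supported vectors) *)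
Definition bulk_bounded (h : bulk_kernel) : Prop :=
  exists M : R, forall s psi,
    (l2norm2 (bulk_apply h s psi) <= (M ^+ 2 * fsnorm2 s psi)%:E)%E.

(* lambda (real) lies in the spectrum of the bounded self-adjoint H^bulk iff
   H^bulk - lambda is not invertible, i.e. (self-adjointness) not bounded below;
   bounded below is tested on the dense subspace of finitely supported vectors. *)
Definition in_bulk_spectrum (h : bulk_kernel) (lambda : R) : Prop :=
  ~ exists c : R, 0 < c /\ forall s psi,
      let phi := (fun x => bulk_apply h s psi x - real_complex R lambda *: restr s psi x) in
      ((c ^+ 2 * fsnorm2 s psi)%:E <= l2norm2 phi)%E.

Definition bulk_gap (h : bulk_kernel) (Delta : R) : Prop :=
  forall lambda : R, - Delta < lambda < Delta -> ~ in_bulk_spectrum h lambda.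

Definition short_range (h : bulk_kernel) (d K : R) : Prop :=
  forall x : int,
    (\esum_(x' in [set: int]) (opnorm (h x x') * expR ((`|x - x'|)%:~R / d))%:E
      <= K%:E)%E.

(* ---------- open chain of length L: basis |x,s>, index i <-> (x, s) = (i/2, i mod 2) *)
Definition site (L : nat) (i : 'I_(L * 2)) : nat := (i %/ 2)%N.
Definition spin (L : nat) (i : 'I_(L * 2)) : 'I_2 := inord (i %% 2).

Definition chain_restrict (h : bulk_kernel) (L : nat) : 'M[R[i]]_(L * 2) :=
  \matrix_(i, j) h (site i)%:Z (site j)%:Z (spin i) (spin j).

Definition chiralL (L : nat) : 'M[R[i]]_(L * 2) :=
  diag_mx (\row_i (if spin i == ord0 then 1 else -1)).

Definition theta (L x : nat) : R[i] := if (x < L./2)%N then 1 else 0.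
Definition thetaX (L : nat) : 'M[R[i]]_(L * 2) := diag_mx (\row_i theta L (site i)).

Definition unitary n (U : 'M[R[i]]_n) : Prop := U *m mxstar U = 1%:M.
Definition mx_fcalc n (f : R -> R) (M F : 'M[R[i]]_n) : Prop :=
  exists (U : 'M[R[i]]_n) (D : 'rV[R]_n), unitary U /\
    M = U *m diag_mx (map_mx (fun t => real_complex R t) D) *m mxstar U /\
    F = U *m diag_mx (map_mx (fun t => real_complex R (f t)) D) *m mxstar U.

Definition tanh (t : R) : R := (expR t - expR (- t)) / (expR t + expR (- t)).

(* evaluation point (K_d, d, L) for a polynomial in 3 variables *)
Definition pt3 (a b c : R) : 'I_3 -> R := fun i => nth 0 [:: a; b; c] i.

End Defs.

(* Main.v *)
Require Import Defs.
From HB Require Import structures.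
From mathcomp Require Import all_boot all_order all_algebra.
From mathcomp Require Import all_classical all_reals all_analysis.
From mathcomp Require Import complex zify ring lra.
From mathcomp Require mpoly.
Import Order.TTheory GRing.Theory Num.Theory.
Local Open Scope ring_scope.

Set Implicit Arguments.
Unset Strict Implicit.
Unset Printing Implicit Defensive.

(** Since [C] anticommutes with [S] and [Tr (C theta) = 0], the two indices are equal;
    in an eigenbasis of [H] with eigenvalues [D i] and with [X = C theta] they read
    [sum_i X_ii (1 - tanh^2 (D_i / delta))].

    The bulk gap gives [Delta |psi| <= |H_bulk psi|], and Agmon's weighted estimate then
    shows that chain eigenvectors of energy at most [3 Delta / 4] are exponentially small
    in the middle of the chain, so that [[theta, H]] almost annihilates them.  Because
    [C [theta, H] = X H + H X], this says that [X_ij (D_i + D_j)] is tiny whenever [j] is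
    low-energy.  For [i = j] it makes [X_ii tanh^2 (D_i / delta)] negligible; for [j] below
    and [i] above a spectral gap (found by pigeonhole in the window
    [[Delta / 2, 3 Delta / 4]]) it shows that the low-energy projection [P] almost
    commutes with [X].  As [X^3 = X], the Hermitian matrix [P X P] has spectrum close to
    [{-1, 0, 1}] and its trace is close to an integer.  Energies above [Delta / 2]
    contribute at most [4 exp (- Delta / delta)] each. *)

(** * Moduli of complex numbers *)

Section ComplexModulus.
Context {R : realType}.
Implicit Types (z w : R[i]) (r : R).

Local Notation RtoC := (real_complex R).

Lemma cabs_normc z : cabs z = Normc.normc z.
Proof. by case: z. Qed.

Lemma cabs_ge0 z : 0 <= cabs z.
Proof. exact: sqrtr_ge0. Qed.

Lemma cabs2_ge0 z : 0 <= cabs2 z.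
Proof. by rewrite /cabs2 addr_ge0 ?sqr_ge0. Qed.

Lemma sqr_cabs z : cabs z ^+ 2 = cabs2 z.
Proof. by rewrite /cabs sqr_sqrtr ?cabs2_ge0. Qed.

Lemma cabs0 : cabs (0 : R[i]) = 0.
Proof. by rewrite cabs_normc Normc.normc0. Qed.

Lemma cabsM z w : cabs (z * w) = cabs z * cabs w.
Proof. by rewrite !cabs_normc Normc.normcM. Qed.

Lemma cabsN z : cabs (- z) = cabs z.
Proof. by rewrite !cabs_normc normcN. Qed.

Lemma ler_cabsD z w : cabs (z + w) <= cabs z + cabs w.
Proof. by rewrite !cabs_normc le_normcD. Qed.

Lemma cabs_real r : cabs (RtoC r) = `|r|.
Proof. by rewrite /cabs /cabs2 /= expr0n /= addr0 sqrtr_sqr. Qed.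

Lemma cabs_conj z : cabs (conjc z) = cabs z.
Proof. by rewrite /cabs /cabs2; case: z => a b /=; rewrite sqrrN. Qed.

Lemma ler_cabs_sum (I : Type) (s : seq I) (P : pred I) (F : I -> R[i]) :
  cabs (\sum_(i <- s | P i) F i) <= \sum_(i <- s | P i) cabs (F i).
Proof.
elim/big_rec2: _ => [|i y x _ le_xy]; first by rewrite cabs0.
exact: le_trans (ler_cabsD _ _) (lerD _ _).
Qed.

Lemma Re_sum (I : Type) (s : seq I) (P : pred I) (F : I -> R[i]) :
  complex.Re (\sum_(i <- s | P i) F i) = \sum_(i <- s | P i) complex.Re (F i).
Proof.
elim/big_rec2: _ => [//|i y x _ <-].
by case: (F i) => a b; case: x => c d.
Qed.

End ComplexModulus.

(** * Conjugate transposes *)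

Section Adjoint.
Context {R : realType}.

Lemma mxstarE m n (A : 'M[R[i]]_(m, n)) i j : mxstar A i j = conjc (A j i).
Proof. by rewrite /mxstar !mxE. Qed.

Lemma mxstarK m n (A : 'M[R[i]]_(m, n)) : mxstar (mxstar A) = A.
Proof. by apply/matrixP => i j; rewrite !mxstarE conjcK. Qed.

Lemma mxstarM m n p (A : 'M[R[i]]_(m, n)) (B : 'M[R[i]]_(n, p)) :
  mxstar (A *m B) = mxstar B *m mxstar A.
Proof. by rewrite /mxstar trmx_mul map_mxM. Qed.

Lemma mxstarD m n (A B : 'M[R[i]]_(m, n)) : mxstar (A + B) = mxstar A + mxstar B.
Proof. by rewrite /mxstar linearD /= map_mxD. Qed.

Lemma mxstarZ m n (r : R) (A : 'M[R[i]]_(m, n)) :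
  mxstar (real_complex R r *: A) = real_complex R r *: mxstar A.
Proof.
by apply/matrixP => i j; rewrite !mxE rmorphM /=; congr (_ * _); rewrite /= oppr0.
Qed.

End Adjoint.

(** * Real Euclidean structure on complex vectors *)

Section RealInnerProduct.
Context {R : realType}.
Implicit Types (r : R).
Local Notation RtoC := (real_complex R).

(** The estimates below scale vectors by reals only, so the real part of the Hermitian product
    suffices: it is symmetric and bilinear over the reals. *)
Definition vdot n (u v : 'cV[R[i]]_n) : R := complex.Re ((mxstar u *m v) ord0 ord0).

Lemma vdot_sum n (u v : 'cV[R[i]]_n) :
  vdot u v = \sum_i complex.Re (conjc (u i ord0) * v i ord0).
Proof.
by rewrite /vdot mxE Re_sum; apply: eq_bigr => i _; rewrite mxstarE.
Qed.

Lemma vdotC n (u v : 'cV[R[i]]_n) : vdot u v = vdot v u.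
Proof.
rewrite !vdot_sum; apply: eq_bigr => i _.
by case: (u i ord0) => a b; case: (v i ord0) => c d /=; ring.
Qed.

Lemma vdotDl n (u v w : 'cV[R[i]]_n) : vdot (u + v) w = vdot u w + vdot v w.
Proof.
rewrite /vdot mxstarD mulmxDl mxE.
by case: ((mxstar u *m w) _ _) => a b; case: ((mxstar v *m w) _ _) => c d.
Qed.

Lemma vdotZl n r (u w : 'cV[R[i]]_n) : vdot (RtoC r *: u) w = r * vdot u w.
Proof.
rewrite /vdot mxstarZ -scalemxAl mxE.
by case: ((mxstar u *m w) _ _) => a b /=; rewrite mul0r subr0.
Qed.

Lemma vdotDr n (u v w : 'cV[R[i]]_n) : vdot w (u + v) = vdot w u + vdot w v.
Proof. by rewrite vdotC vdotDl !(vdotC w). Qed.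

Lemma vdotZr n r (u w : 'cV[R[i]]_n) : vdot w (RtoC r *: u) = r * vdot w u.
Proof. by rewrite vdotC vdotZl (vdotC w). Qed.

Lemma vdot0l n (w : 'cV[R[i]]_n) : vdot 0 w = 0.
Proof. by rewrite vdot_sum big1 // => i _; rewrite mxE conjc0 mul0r. Qed.

Lemma vdot0r n (w : 'cV[R[i]]_n) : vdot w 0 = 0.
Proof. by rewrite vdotC vdot0l. Qed.

Lemma vdot_suml n (I : Type) (s : seq I) (P : pred I) (F : I -> 'cV[R[i]]_n) w :
  vdot (\sum_(i <- s | P i) F i) w = \sum_(i <- s | P i) vdot (F i) w.
Proof. by elim/big_rec2: _ => [|i y x _ <-]; rewrite ?vdot0l ?vdotDl. Qed.

Lemma vdot_sumr n (I : Type) (s : seq I) (P : pred I) (F : I -> 'cV[R[i]]_n) w :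
  vdot w (\sum_(i <- s | P i) F i) = \sum_(i <- s | P i) vdot w (F i).
Proof. by rewrite vdotC vdot_suml; apply: eq_bigr => i _; rewrite vdotC. Qed.

Lemma vdot_adj m n (A : 'M[R[i]]_(m, n)) u v : vdot (mxstar A *m u) v = vdot u (A *m v).
Proof. by rewrite /vdot mxstarM mxstarK mulmxA. Qed.

Lemma vnorm2E n (v : 'cV[R[i]]_n) : vnorm2 v = vdot v v.
Proof.
rewrite vdot_sum; apply: eq_bigr => i _; rewrite /cabs2.
by case: (v i ord0) => a b /=; ring.
Qed.

Lemma vnorm2_ge0 n (v : 'cV[R[i]]_n) : 0 <= vnorm2 v.
Proof. by apply: sumr_ge0 => i _; apply: cabs2_ge0. Qed.

Lemma vnorm20 n : vnorm2 (0 : 'cV[R[i]]_n) = 0.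
Proof. by rewrite vnorm2E vdot0l. Qed.

Lemma vnorm2_eq0 n (v : 'cV[R[i]]_n) : vnorm2 v = 0 -> v = 0.
Proof.
move=> v0; apply/colP => i; rewrite mxE.
have /psumr_eq0P : forall j, true -> 0 <= cabs2 (v j ord0) by move=> *; apply: cabs2_ge0.
move=> /(_ v0 i isT) /eqP; rewrite -sqr_cabs sqrf_eq0 cabs_normc => /eqP.
exact: Normc.eq0_normc.
Qed.

Lemma vnorm2D n (u v : 'cV[R[i]]_n) :
  vnorm2 (u + v) = vnorm2 u + 2 * vdot u v + vnorm2 v.
Proof. by rewrite !vnorm2E !vdotDl !vdotDr (vdotC v u); ring. Qed.

Lemma vnorm2Z n r (u : 'cV[R[i]]_n) : vnorm2 (RtoC r *: u) = r ^+ 2 * vnorm2 u.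
Proof. by rewrite !vnorm2E vdotZl vdotZr mulrA. Qed.

Lemma vdot_CauchySchwarz n (u v : 'cV[R[i]]_n) :
  vdot u v ^+ 2 <= vnorm2 u * vnorm2 v.
Proof.
have [v0|vN0] := eqVneq (vnorm2 v) 0.
  by rewrite (vnorm2_eq0 v0) vdot0r vnorm20 mulr0 expr0n.
have v_gt0 : 0 < vnorm2 v by rewrite lt_def vN0 vnorm2_ge0.
(* With b = |v|^2 and p = <u, v>, expanding |b u - p v|^2 >= 0 leaves a common factor b > 0 to
   cancel. *)
have := vnorm2_ge0 (RtoC (vnorm2 v) *: u + RtoC (- vdot u v) *: v).
rewrite vnorm2D !vnorm2Z vdotZl vdotZr.
set a := vnorm2 u; set b := vnorm2 v; set p := vdot u v.
have -> : b ^+ 2 * a + 2 * (b * (- p * p)) + (- p) ^+ 2 * b = b * (a * b - p ^+ 2) by ring.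
by rewrite pmulr_rge0 // subr_ge0.
Qed.

Lemma vdot_young n r (u v : 'cV[R[i]]_n) :
  0 < r -> - (2 * vdot u v) <= r * vnorm2 u + r^-1 * vnorm2 v.
Proof.
move=> r0; have := vnorm2_ge0 (RtoC r *: u + v).
rewrite vnorm2D vnorm2Z vdotZl => h.
rewrite -(ler_pM2l r0) mulrDr !mulrA mulfV ?gt_eqF // mul1r.
by move: h; rewrite expr2; lra.
Qed.

Lemma cabs2_le_vnorm2 n (v : 'cV[R[i]]_n) i : cabs2 (v i ord0) <= vnorm2 v.
Proof.
rewrite /vnorm2 (bigD1 i) //= lerDl.
by apply: sumr_ge0 => j _; apply: cabs2_ge0.
Qed.

Lemma vnorm2_delta n (i : 'I_n) : vnorm2 (delta_mx i ord0 : 'cV[R[i]]_n) = 1.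
Proof.
rewrite /vnorm2 (bigD1 i) //= mxE !eqxx big1 => [|j /negbTE ji].
  by rewrite /cabs2 /= expr1n expr0n !addr0.
by rewrite mxE ji /cabs2 /= expr0n addr0.
Qed.

Lemma vnorm2_unitary n (U : 'M[R[i]]_n) v : mxstar U *m U = 1%:M -> vnorm2 (U *m v) = vnorm2 v.
Proof. by move=> UU; rewrite !vnorm2E -vdot_adj mulmxA UU mul1mx. Qed.

End RealInnerProduct.

(** * The operator norm of a matrix *)

Section OperatorNorm.
Context {R : realType}.
Local Notation RtoC := (real_complex R).
Local Open Scope classical_set_scope.

Let image_of_sphere m n (A : 'M[R[i]]_(m, n)) : set R :=
  [set Num.sqrt (vnorm2 (A *m v)) | v in [set v : 'cV[R[i]]_n | vnorm2 v = 1]].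

(** A crude entrywise bound, whose purpose is to show that the supremum defining [opnorm] runs over
    a bounded set. *)
Lemma vnorm2_mulmx_frobenius m n (A : 'M[R[i]]_(m, n)) v :
  vnorm2 (A *m v) <= (\sum_i \sum_j cabs (A i j)) ^+ 2 * vnorm2 v.
Proof.
have cabs_v j : cabs (v j ord0) <= Num.sqrt (vnorm2 v).
  by rewrite /cabs ler_wsqrtr // cabs2_le_vnorm2.
have rowle i : cabs ((A *m v) i ord0) <= (\sum_j cabs (A i j)) * Num.sqrt (vnorm2 v).
  rewrite mxE; apply: le_trans (ler_cabs_sum _ _ _) _.
  rewrite mulr_suml; apply: ler_sum => j _; rewrite cabsM.
  by rewrite ler_wpM2l ?cabs_ge0.
have row_ge0 i : 0 <= \sum_j cabs (A i j) by apply: sumr_ge0 => j _; apply: cabs_ge0.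
have -> : vnorm2 v = Num.sqrt (vnorm2 v) ^+ 2 by rewrite sqr_sqrtr ?vnorm2_ge0.
rewrite -exprMn mulr_suml.
apply: le_trans (_ : \sum_i (\sum_j cabs (A i j) * Num.sqrt (vnorm2 v)) ^+ 2 <= _).
  apply: ler_sum => i _; rewrite -sqr_cabs -mulr_suml ler_sqr ?nnegrE ?cabs_ge0 ?rowle //.
  by rewrite mulr_ge0 ?sqrtr_ge0.
rewrite [leRHS](_ : _ = (\sum_i (\sum_j cabs (A i j) * Num.sqrt (vnorm2 v))) ^+ 2); last first.
  by congr (_ ^+ 2); apply: eq_bigr => i _; rewrite mulr_suml.
have f_ge0 i : 0 <= \sum_j cabs (A i j) * Num.sqrt (vnorm2 v).
  by rewrite -mulr_suml mulr_ge0 ?sqrtr_ge0.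
rewrite expr2 mulr_suml; apply: ler_sum => i _.
rewrite expr2 ler_wpM2l // (bigD1 i) //= lerDl.
by apply: sumr_ge0.
Qed.

(** The number of columns is a successor so that the unit sphere is nonempty; on an empty set [sup]
    would be a mere default value. *)
Lemma opnorm_has_sup m n (A : 'M[R[i]]_(m, n.+1)) : has_sup (image_of_sphere A).
Proof.
split.
  exists (Num.sqrt (vnorm2 (A *m delta_mx ord0 ord0))), (delta_mx ord0 ord0) => //=.
  exact: vnorm2_delta.
exists (Num.sqrt ((\sum_i \sum_j cabs (A i j)) ^+ 2)) => _ [v /= v1 <-].
by rewrite ler_wsqrtr // (le_trans (vnorm2_mulmx_frobenius _ _)) // v1 mulr1.
Qed.

Lemma opnorm_ge0 m n (A : 'M[R[i]]_(m, n.+1)) : 0 <= opnorm A.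
Proof.
have [[r Sr] ubS] := opnorm_has_sup A.
apply: le_trans (ub_le_sup ubS Sr).
by case: Sr => v _ <-; apply: sqrtr_ge0.
Qed.

Lemma vnorm2_mulmx_le m n (A : 'M[R[i]]_(m, n.+1)) v :
  vnorm2 (A *m v) <= opnorm A ^+ 2 * vnorm2 v.
Proof.
have [v0|vN0] := eqVneq (vnorm2 v) 0.
  by rewrite (vnorm2_eq0 v0) mulmx0 !vnorm20 mulr0.
have v_gt0 : 0 < vnorm2 v by rewrite lt_def vN0 vnorm2_ge0.
set c := Num.sqrt (vnorm2 v).
have c_gt0 : 0 < c by rewrite sqrtr_gt0.
have c2 : c ^+ 2 = vnorm2 v by rewrite sqr_sqrtr ?ltW.
have [_ ubS] := opnorm_has_sup A.
have : Num.sqrt (vnorm2 (A *m (RtoC c^-1 *: v))) <= opnorm A.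
  apply: ub_le_sup => //; exists (RtoC c^-1 *: v) => //=.
  by rewrite vnorm2Z -c2 exprVn mulVf // expf_neq0 // gt_eqF.
rewrite -scalemxAr vnorm2Z => le_op.
have := lerXn2r 2 _ _ le_op.
rewrite !nnegrE sqrtr_ge0 opnorm_ge0 => /(_ isT isT).
rewrite sqr_sqrtr; last by rewrite mulr_ge0 ?sqr_ge0 ?vnorm2_ge0.
by rewrite -c2 exprVn ler_pdivrMl ?exprn_gt0 // mulrC.
Qed.

(** For a unit vector v and w = [mxstar A *m v], Cauchy-Schwarz gives |w|^2 = <v, A w> <= |A| |w|,
    and one factor |w| cancels. *)
Lemma opnorm_adj m n (A : 'M[R[i]]_(m.+1, n.+1)) : opnorm (mxstar A) <= opnorm A.
Proof.
have [nonempty _] := opnorm_has_sup (mxstar A).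
apply: ge_sup => // _ [v /= v1 <-].
rewrite -[leRHS]ger0_norm ?opnorm_ge0 // -sqrtr_sqr ler_wsqrtr //.
set w := mxstar A *m v.
have [->|wN0] := eqVneq (vnorm2 w) 0; first exact: sqr_ge0.
have w_gt0 : 0 < vnorm2 w by rewrite lt_def wN0 vnorm2_ge0.
have := vdot_CauchySchwarz v (A *m w).
rewrite -vdot_adj -/w -vnorm2E v1 mul1r expr2 => h.
have := le_trans h (vnorm2_mulmx_le A w).
by rewrite ler_pM2r.
Qed.

End OperatorNorm.

(** * Sums over the integers and over duplicate-free lists *)

Section FiniteSums.
Context {R : realType}.
Local Open Scope classical_set_scope.

Lemma sum_le_esum (f : int -> R) s : (forall x, 0 <= f x) -> uniq s ->
  ((\sum_(x <- s) f x)%:E <= \esum_(x in [set: int]) (f x)%:E)%E.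
Proof.
move=> f0 us; apply: esum_ge; exists [set` s].
  by split => //; apply: finite_seq.
by rewrite -fsbig_seq // sumEFin.
Qed.

Lemma esum_le_sum (f : int -> R) b :
  (forall s, uniq s -> \sum_(x <- s) f x <= b) ->
  (\esum_(x in [set: int]) (f x)%:E <= b%:E)%E.
Proof.
move=> fb; apply: ge_ereal_sup => _ [X [/finite_seqP[s ->] _] <-].
rewrite (_ : [set` s] = [set` undup s]); last first.
  by apply/seteqP; split => x /=; rewrite mem_undup.
by rewrite -fsbig_seq ?undup_uniq // sumEFin lee_fin fb ?undup_uniq.
Qed.

Lemma ler_sum_uniq (f : int -> R) (s t : seq int) : (forall x, 0 <= f x) ->
  uniq s -> uniq t -> {subset s <= t} -> \sum_(x <- s) f x <= \sum_(x <- t) f x.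
Proof.
move=> f0 us ut st; rewrite [leRHS](bigID (mem s)) /=.
rewrite -[\sum_(i <- t | i \in s) _]big_filter.
have /(perm_big s) -> /= : perm_eq [seq x <- t | x \in s] s.
  apply: uniq_perm => //; first exact: filter_uniq.
  by move=> x; rewrite mem_filter; case xs: (x \in s) => //=; apply: st.
by rewrite lerDl sumr_ge0.
Qed.

Lemma sum_uniq_supp (V : nmodType) (f : int -> V) (s t : seq int) :
  uniq s -> uniq t -> {subset s <= t} -> (forall x, x \notin s -> f x = 0) ->
  \sum_(x <- t) f x = \sum_(x <- s) f x.
Proof.
move=> us ut st f0; rewrite (bigID (mem s)) /= [X in _ + X]big1 // addr0.
rewrite -big_filter; apply: perm_big; apply: uniq_perm => //; first exact: filter_uniq.
by move=> x; rewrite mem_filter; case xs: (x \in s) => //=; apply: st.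
Qed.

Lemma lt_esum_sum (f : int -> R) b (s0 : seq int) : (forall x, 0 <= f x) ->
  (b%:E < \esum_(x in [set: int]) (f x)%:E)%E ->
  exists s, [/\ uniq s, {subset s0 <= s} & b < \sum_(x <- s) f x].
Proof.
move=> f0 bf.
have [s [us bs]] : exists s, uniq s /\ b < \sum_(x <- s) f x.
  apply: contrapT => ns; move: bf; apply/negP; rewrite -leNgt.
  apply: esum_le_sum => s us; rewrite leNgt; apply/negP => bs.
  by apply: ns; exists s.
exists (undup (s0 ++ s)); split; first exact: undup_uniq.
  by move=> x xs; rewrite mem_undup mem_cat xs.
apply: lt_le_trans bs _; apply: ler_sum_uniq => //; first exact: undup_uniq.
by move=> x xs; rewrite mem_undup mem_cat xs orbT.
Qed.

End FiniteSums.

(** * Schur's test for short-range kernels *)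

Section SchurTest.
Context {R : realType}.
Local Notation RtoC := (real_complex R).

(** Cauchy-Schwarz for vectors with |z_y| <= a_y sqrt(b_y), arranged as an induction that never
    takes a square root. *)
Lemma vnorm2_sum_le n (I : Type) (s : seq I) (z : I -> 'cV[R[i]]_n) (a b : I -> R) :
  (forall y, 0 <= a y) -> (forall y, 0 <= b y) ->
  (forall y, vnorm2 (z y) <= a y ^+ 2 * b y) ->
  vnorm2 (\sum_(y <- s) z y) <= (\sum_(y <- s) a y) * (\sum_(y <- s) a y * b y).
Proof.
move=> a0 b0 zab; elim: s => [|y s IH]; first by rewrite !big_nil vnorm20 mulr0.
rewrite !big_cons vnorm2D.
set p := \sum_(j <- s) z j in IH *; set A := \sum_(j <- s) a j in IH *.
set B := \sum_(j <- s) a j * b j in IH *.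
have A0 : 0 <= A by apply: sumr_ge0.
have B0 : 0 <= B by apply: sumr_ge0 => j _; apply: mulr_ge0.
have [[ay by0] zy] := (a0 y, b0 y, zab y).
(* After squaring, this is Cauchy-Schwarz followed by 4 p q <= (p + q)^2 with p = a_y B and q = A
   a_y b_y. *)
have cross : 2 * vdot (z y) p <= a y * B + A * (a y * b y).
  have rhs0 : 0 <= a y * B + A * (a y * b y) by rewrite addr_ge0 ?mulr_ge0.
  apply: le_trans (ler_norm _) _.
  rewrite -(@ler_pXn2r _ 2) ?nnegrE //= real_normK ?num_real // exprMn.
  have cs := vdot_CauchySchwarz (z y) p.
  have le1 : vnorm2 (z y) * vnorm2 p <= (a y ^+ 2 * b y) * (A * B).
    by apply: ler_pM => //; apply: vnorm2_ge0.
  have sq := sqr_ge0 (a y * B - A * (a y * b y)).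
  have -> : (a y * B + A * (a y * b y)) ^+ 2 =
    (a y * B - A * (a y * b y)) ^+ 2 + 4 * ((a y ^+ 2 * b y) * (A * B)) by ring.
  by move: cs le1 sq; lra.
have -> : (a y + A) * (a y * b y + B) =
  a y ^+ 2 * b y + (a y * B + A * (a y * b y)) + A * B by ring.
by rewrite !lerD.
Qed.

Variables (h : bulk_kernel R) (d K : R).
Hypotheses (sa : bulk_selfadjoint h) (sr : short_range h d K).

Lemma short_range_row x s : uniq s ->
  \sum_(y <- s) opnorm (h x y) * expR (`|x - y|%:~R / d) <= K.
Proof.
move=> us; rewrite -lee_fin.
pose f (y : int) := opnorm (h x y) * expR (`|x - y|%:~R / d).
apply: le_trans (sr x); apply: (@sum_le_esum _ f) => // y.
by rewrite mulr_ge0 ?opnorm_ge0 ?expR_ge0.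
Qed.

(** Row sums are bounded by the short-range assumption, and column sums reduce to row sums by
    self-adjointness. The multiplier [k] may grow as fast as the exponential weight, because that
    weight is already included in the sums bounded by [K]. *)
Lemma schur_test (c : R) (k : int -> int -> R) (F s : seq int) (u : int -> 'cV[R[i]]_2) :
  0 <= c -> (forall x y, `|k x y| <= c * expR (`|x - y|%:~R / d)) ->
  uniq F -> uniq s ->
  \sum_(x <- F) vnorm2 (\sum_(y <- s) RtoC (k x y) *: (h x y *m u y)) <=
    (c * K) ^+ 2 * \sum_(y <- s) vnorm2 (u y).
Proof.
move=> c0 kc uF us.
pose a x y := opnorm (h x y) * expR (`|x - y|%:~R / d).
have a0 x y : 0 <= a x y by rewrite mulr_ge0 ?opnorm_ge0 ?expR_ge0.
have aC x y : a x y <= a y x.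
  by rewrite /a (sa y x) distrC; apply: ler_wpM2r; [exact: expR_ge0|exact: opnorm_adj].
have K0 : 0 <= K by apply: le_trans (short_range_row 0 (isT : uniq [::])); rewrite big_nil.
have row x : vnorm2 (\sum_(y <- s) RtoC (k x y) *: (h x y *m u y)) <=
    c * K * \sum_(y <- s) c * a x y * vnorm2 (u y).
  apply: le_trans (_ : (\sum_(y <- s) c * a x y) *
      (\sum_(y <- s) c * a x y * vnorm2 (u y)) <= _).
    apply: vnorm2_sum_le => y; rewrite ?mulr_ge0 ?vnorm2_ge0 ?opnorm_ge0 ?expR_ge0 //.
    rewrite vnorm2Z; apply: le_trans (_ : k x y ^+ 2 * (opnorm (h x y) ^+ 2 * vnorm2 (u y)) <= _).
      by rewrite ler_wpM2l ?sqr_ge0 ?vnorm2_mulmx_le.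
    rewrite mulrA ler_wpM2r ?vnorm2_ge0 // -exprMn -[leLHS]real_normK ?num_real //.
    rewrite lerXn2r ?nnegrE ?mulr_ge0 ?opnorm_ge0 ?expR_ge0 //.
    rewrite normrM [`|opnorm _|]ger0_norm ?opnorm_ge0 //.
    by rewrite /a mulrCA mulrC ler_wpM2l ?opnorm_ge0.
  rewrite ler_wpM2r //.
    by apply: sumr_ge0 => y _; rewrite !mulr_ge0 ?vnorm2_ge0 ?opnorm_ge0 ?expR_ge0.
  by rewrite -mulr_sumr ler_wpM2l // short_range_row.
apply: le_trans (ler_sum _ (fun x _ => row x)) _.
rewrite -mulr_sumr exchange_big /= expr2 -mulrA ler_wpM2l ?mulr_ge0 //.
rewrite mulr_sumr; apply: ler_sum => y _.
rewrite -mulr_suml ler_wpM2r ?vnorm2_ge0 // -mulr_sumr ler_wpM2l //.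
apply: le_trans (short_range_row y uF); exact: ler_sum.
Qed.

End SchurTest.

(** * Quadratic forms of the bulk operator on finite lists of sites *)

Section FiniteBlocks.
Context {R : realType}.
Local Notation RtoC := (real_complex R).
Implicit Types (G s : seq int) (u v w : int -> 'cV[R[i]]_2).

Definition norm2_on G u : R := \sum_(x <- G) vnorm2 (u x).
Definition dot_on G u v : R := \sum_(x <- G) vdot (u x) (v x).

Lemma norm2_on_ge0 G u : 0 <= norm2_on G u.
Proof. by apply: sumr_ge0 => x _; apply: vnorm2_ge0. Qed.

Lemma fsnorm2_uniq s u : uniq s -> fsnorm2 s u = norm2_on s u.
Proof. by move=> us; rewrite /fsnorm2 undup_id. Qed.

Lemma norm2_on_restr s G u : uniq s -> uniq G -> {subset s <= G} ->
  norm2_on G (restr s u) = norm2_on s u.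
Proof.
move=> us uG sG; rewrite /norm2_on (sum_uniq_supp us uG sG) => [|x xs].
  by apply: eq_big_seq => x xs; rewrite /restr xs.
by rewrite /restr (negbTE xs) vnorm20.
Qed.

Variable h : bulk_kernel R.

Lemma bulk_apply_restr s G u : uniq s -> uniq G -> {subset s <= G} ->
  bulk_apply h G (restr s u) =1 bulk_apply h s u.
Proof.
move=> us uG sG x; rewrite /bulk_apply !undup_id // (sum_uniq_supp us uG sG) => [|y ys].
  by apply: eq_big_seq => y ys; rewrite /restr ys.
by rewrite /restr (negbTE ys) mulmx0.
Qed.

Lemma bulk_applyD G u v x :
  bulk_apply h G (fun y => u y + v y) x = bulk_apply h G u x + bulk_apply h G v x.
Proof.
rewrite /bulk_apply -big_split /=.
by apply: eq_bigr => y _; rewrite mulmxDr.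
Qed.

Lemma bulk_applyZ G c u x :
  bulk_apply h G (fun y => c *: u y) x = c *: bulk_apply h G u x.
Proof.
rewrite /bulk_apply scaler_sumr.
by apply: eq_bigr => y _; rewrite scalemxAr.
Qed.

Hypothesis sa : bulk_selfadjoint h.

Lemma bulk_apply_sym G u v : uniq G ->
  dot_on G (bulk_apply h G u) v = dot_on G u (bulk_apply h G v).
Proof.
move=> uG; rewrite /dot_on /bulk_apply undup_id //.
under eq_bigr do rewrite vdot_suml.
rewrite exchange_big /=; apply: eq_bigr => y _.
rewrite vdot_sumr; apply: eq_bigr => x _.
by rewrite (sa y x) vdot_adj.
Qed.

(* If [(A + m) u = phi + r] and [v] represents [(A - m) phi], then moving [u]
   in the direction of [v] lowers [|A u|^2 - m^2 |u|^2], up to the error [r]. *)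
Lemma energy_decrease G u phi v r (m K : R) :
  let A := bulk_apply h G in
  let w := fun x => u x - RtoC (2 * K ^+ 2)^-1 *: v x in
  uniq G -> 0 < K -> m ^+ 2 <= K ^+ 2 ->
  (forall z, norm2_on G (A z) <= K ^+ 2 * norm2_on G z) ->
  {in G, forall x, A u x + RtoC m *: u x = phi x + r x} ->
  dot_on G (fun x => A phi x - RtoC m *: phi x) v = norm2_on G v ->
  norm2_on G (A w) - m ^+ 2 * norm2_on G w <=
  norm2_on G (A u) - m ^+ 2 * norm2_on G u + 2 * norm2_on G r
    - norm2_on G v / (4 * K ^+ 2).
Proof.
move=> A w uG K0 mK bA Au Aphi.
set s := (2 * K ^+ 2)^-1 in w *.
have Aw x : A w x = A u x + RtoC (- s) *: A v x.
  rewrite -bulk_applyZ -bulk_applyD.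
  by congr bulk_apply; apply/funext => y; rewrite /w rmorphN scaleNr.
have wE x : w x = u x + RtoC (- s) *: v x by rewrite /w rmorphN scaleNr.
have nAw : norm2_on G (A w) = norm2_on G (A u) - 2 * s * dot_on G (A u) (A v)
    + s ^+ 2 * norm2_on G (A v).
  rewrite /norm2_on /dot_on !mulr_sumr -sumrB -big_split /=.
  by apply: eq_bigr => x _; rewrite Aw vnorm2D vdotZr vnorm2Z; ring.
have nw : norm2_on G w = norm2_on G u - 2 * s * dot_on G u v + s ^+ 2 * norm2_on G v.
  rewrite /norm2_on /dot_on !mulr_sumr -sumrB -big_split /=.
  by apply: eq_bigr => x _; rewrite wE vnorm2D vdotZr vnorm2Z; ring.
pose z x := A v x + RtoC (- m) *: v x.
have dotz f : dot_on G f z = dot_on G f (A v) - m * dot_on G f v.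
  rewrite /dot_on mulr_sumr -sumrB.
  by apply: eq_bigr => x _; rewrite vdotDr vdotZr; ring.
have symu : dot_on G (A u) v = dot_on G u (A v) by apply: bulk_apply_sym.
have symphi : dot_on G (A phi) v = dot_on G phi (A v) by apply: bulk_apply_sym.
(* By symmetry of A the left side is <(A + m) u, (A - m) v> = <phi + r, z>, and pairing [phi] with
   [z] gives |v|^2. This is the first-order change of the energy along [v]. *)
have eqz : dot_on G (A u) (A v) - m ^+ 2 * dot_on G u v = norm2_on G v + dot_on G r z.
  have <- : dot_on G phi z = norm2_on G v.
    rewrite dotz -symphi -Aphi /dot_on mulr_sumr -sumrB; apply: eq_bigr => x _.
    have -> : A phi x - RtoC m *: phi x = A phi x + RtoC (- m) *: phi x by rewrite rmorphN scaleNr.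
    by rewrite vdotDl vdotZl; ring.
  have -> : dot_on G phi z + dot_on G r z = dot_on G (A u) z + m * dot_on G u z.
    rewrite /dot_on mulr_sumr -!big_split /=; apply: eq_big_seq => x xG.
    by rewrite -vdotDl -Au // vdotDl vdotZl.
  by rewrite !dotz symu; ring.
have K2 : 0 < K ^+ 2 by rewrite exprn_gt0.
have nz : norm2_on G z <= 4 * K ^+ 2 * norm2_on G v.
  apply: le_trans (_ : 2 * norm2_on G (A v) + 2 * m ^+ 2 * norm2_on G v <= _).
    rewrite /norm2_on !mulr_sumr -big_split /=; apply: ler_sum => x _.
    have := vnorm2_ge0 (A v x + RtoC m *: v x).
    by rewrite !vnorm2D !vdotZr !vnorm2Z sqrrN; lra.
  have := bA v; have := norm2_on_ge0 G v.
  set a := norm2_on G v; set b := norm2_on G (A v) => a0 b0.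
  have : m ^+ 2 * a <= K ^+ 2 * a by rewrite ler_wpM2r.
  by lra.
(* The parameter 4 K^2 matches the bound on |z|^2. The linear term gains 2 s |v|^2; this error takes
   back s |v|^2 and the quadratic term at most s |v|^2 / 2, so that s |v|^2 / 2 = |v|^2 / (4 K^2)
   remains. *)
have young : - (2 * dot_on G r z) <= 4 * K ^+ 2 * norm2_on G r + norm2_on G v.
  apply: le_trans (_ : 4 * K ^+ 2 * norm2_on G r + (4 * K ^+ 2)^-1 * norm2_on G z <= _).
    rewrite /dot_on /norm2_on !mulr_sumr -sumrN -big_split /=; apply: ler_sum => x _.
    by apply: vdot_young; rewrite mulr_gt0.
  by rewrite lerD2l ler_pdivrMl ?mulr_gt0.
have v0 := norm2_on_ge0 G v.
have bv := bA v.
have s0 : 0 < s by rewrite invr_gt0 mulr_gt0.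
have sK : s * K ^+ 2 = 1 / 2 by rewrite /s; field; rewrite gt_eqF.
have -> : norm2_on G v / (4 * K ^+ 2) = s * norm2_on G v / 2.
  by rewrite /s; field; rewrite gt_eqF.
rewrite nAw nw.
have -> : norm2_on G (A u) - 2 * s * dot_on G (A u) (A v) + s ^+ 2 * norm2_on G (A v) -
    m ^+ 2 * (norm2_on G u - 2 * s * dot_on G u v + s ^+ 2 * norm2_on G v) =
    norm2_on G (A u) - m ^+ 2 * norm2_on G u
    - 2 * s * (dot_on G (A u) (A v) - m ^+ 2 * dot_on G u v)
    + s ^+ 2 * norm2_on G (A v) - (m * s) ^+ 2 * norm2_on G v by ring.
rewrite eqz.
have e1 : s * (- (2 * dot_on G r z)) <= s * (4 * K ^+ 2 * norm2_on G r + norm2_on G v).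
  by rewrite ler_pM2l.
have e2 : s ^+ 2 * norm2_on G (A v) <= s ^+ 2 * (K ^+ 2 * norm2_on G v).
  by rewrite ler_wpM2l ?sqr_ge0.
have e3 : 0 <= (m * s) ^+ 2 * norm2_on G v by rewrite mulr_ge0 ?sqr_ge0.
have e4 : s ^+ 2 * (K ^+ 2 * norm2_on G v) = s * norm2_on G v / 2.
  have -> : s ^+ 2 * (K ^+ 2 * norm2_on G v) = s * norm2_on G v * (s * K ^+ 2) by ring.
  by rewrite sK; field.
have e5 : s * (4 * K ^+ 2 * norm2_on G r + norm2_on G v) =
    2 * norm2_on G r + s * norm2_on G v.
  rewrite mulrDr; congr (_ + _).
  have -> : s * (4 * K ^+ 2 * norm2_on G r) = 4 * (s * K ^+ 2) * norm2_on G r by ring.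
  by rewrite sK; field.
by rewrite e4 in e2; rewrite e5 in e1; lra.
Qed.

End FiniteBlocks.

(** * From the spectral gap to a lower bound on the energy *)

Section QuantitativeGap.
Context {R : realType}.
Local Notation RtoC := (real_complex R).
Implicit Types (G F s : seq int) (u v w phi : int -> 'cV[R[i]]_2).

Lemma norm2_on_le_l2norm2 G u : uniq G -> ((norm2_on G u)%:E <= l2norm2 u)%E.
Proof. by move=> uG; apply: sum_le_esum => // x; apply: vnorm2_ge0. Qed.

Lemma l2norm2_fin u b : (l2norm2 u <= b%:E)%E -> exists2 e, 0 <= e & l2norm2 u = e%:E.
Proof.
move=> ub; have u0 : (0 <= l2norm2 u)%E.
  by apply: esum_ge0 => x _; rewrite lee_fin vnorm2_ge0.
exists (fine (l2norm2 u)); first exact: fine_ge0.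
by rewrite fineK // ge0_fin_numE // (le_lt_trans ub) ?ltry.
Qed.

(** Images under the bulk operator need not have finite support; this lemma chooses all the
    truncations, nested through [G0]. *)
Lemma l2norm2_exhaust u b (e : R) G0 : (l2norm2 u <= b%:E)%E -> 0 < e ->
  exists G, [/\ uniq G, {subset G0 <= G} & (l2norm2 u <= (norm2_on G u + e)%:E)%E].
Proof.
move=> /l2norm2_fin[l l0 ul] e0.
have : ((l - e)%:E < l2norm2 u)%E by rewrite ul lte_fin ltrBlDr ltrDl.
case/(lt_esum_sum G0 (fun x => vnorm2_ge0 (u x))) => G [uG G0G lG].
by exists G; split => //; rewrite ul lee_fin -lerBlDr ltW.
Qed.

Lemma norm2_on_restr_le F s u : uniq F -> uniq s ->
  norm2_on F (restr s u) <= norm2_on s u.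
Proof.
move=> uF us; rewrite -(norm2_on_restr u us (undup_uniq (s ++ F))); last first.
  by move=> x xs; rewrite mem_undup mem_cat xs.
apply: ler_sum_uniq => // [x||x xF]; rewrite ?vnorm2_ge0 ?undup_uniq //.
by rewrite mem_undup mem_cat xF orbT.
Qed.

Variables (h : bulk_kernel R) (d K : R).
Hypotheses (d0 : 0 < d) (K0 : 0 < K).
Hypotheses (sa : bulk_selfadjoint h) (sr : short_range h d K).

(** Schur's test with the constant multiplier 1: the range constant [K] bounds the bulk operator. *)
Lemma norm2_on_bulk_apply F s u : uniq F -> uniq s ->
  norm2_on F (bulk_apply h s u) <= K ^+ 2 * norm2_on s u.
Proof.
move=> uF us.
have k1 (x y : int) : `|1 : R| <= 1 * expR (`|x - y|%:~R / d).
  rewrite normr1 mul1r -[leLHS]expR0 ler_expR.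
  by apply: divr_ge0; [rewrite ler0z|exact: ltW].
have := schur_test (k := fun _ _ => 1) sa sr u ler01 k1 uF us; rewrite mul1r; apply: le_trans.
rewrite le_eqVlt; apply/orP; left; apply/eqP.
apply: eq_bigr => x _; rewrite /bulk_apply undup_id //; congr vnorm2.
by apply: eq_bigr => y _; rewrite scale1r.
Qed.

Lemma l2norm2_shifted_apply s u (m : R) : uniq s -> m ^+ 2 <= K ^+ 2 ->
  (l2norm2 (fun x => (bulk_apply h s u x - RtoC m *: restr s u x)%R)
     <= (4 * K ^+ 2 * norm2_on s u)%:E)%E.
Proof.
move=> us mK; apply: esum_le_sum => F uF.
apply: le_trans (_ : 2 * norm2_on F (bulk_apply h s u)
                     + 2 * m ^+ 2 * norm2_on F (restr s u) <= _).
  rewrite /norm2_on !mulr_sumr -big_split /=; apply: ler_sum => x _.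
  rewrite -scaleNr -[- RtoC m](rmorphN (real_complex R)).
  have := vnorm2_ge0 (bulk_apply h s u x + RtoC m *: restr s u x).
  by rewrite !vnorm2D !vdotZr !vnorm2Z sqrrN; lra.
have n1 := norm2_on_bulk_apply u uF us.
have n2 := norm2_on_restr_le u uF us.
have n3 : m ^+ 2 * norm2_on F (restr s u) <= K ^+ 2 * norm2_on s u.
  by apply: ler_pM; rewrite ?sqr_ge0 ?norm2_on_ge0.
by lra.
Qed.

Definition bounded_below_at (lambda c : R) := forall s u,
  ((c ^+ 2 * fsnorm2 s u)%:E <=
   l2norm2 (fun x => (bulk_apply h s u x - RtoC lambda *: restr s u x)%R))%E.

(** The form inequality H^2 >= a, tested on finitely supported vectors. *)
Definition energy_above (a : R) := forall s u,
  ((a * fsnorm2 s u)%:E <= l2norm2 (bulk_apply h s u))%E.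

(** If H - m and H + m are bounded below, so is H^2 - m^2 = (H - m)(H + m). A vector with energy too
    close to m^2 could then be moved along (H - m)(H + m) psi to an energy below m^2, contradicting
    H^2 >= m^2. *)
Lemma energy_above_improve (m c1 c2 : R) : m ^+ 2 <= K ^+ 2 ->
  0 < c1 -> 0 < c2 -> bounded_below_at m c1 -> bounded_below_at (- m) c2 ->
  energy_above (m ^+ 2) -> exists2 e, 0 < e & energy_above (m ^+ 2 + e).
Proof.
move=> mK c10 c20 bm bNm Em.
have K2 : 0 < K ^+ 2 by rewrite exprn_gt0.
have c12 : 0 < c1 ^+ 2 by rewrite exprn_gt0.
have c22 : 0 < c2 ^+ 2 by rewrite exprn_gt0.
(* This [e] solves c1^2 c2^2 - (c1^2 + 1) e = 16 K^2 e. The left side, times |psi|^2, bounds |v|^2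
   below after two truncations. The right side makes the decrease |v|^2 / (4 K^2) at least four
   units e |psi|^2: one for the energy excess of [psi], two for the tail [r], one for truncating H
   w. *)
pose e := c1 ^+ 2 * c2 ^+ 2 / (16 * K ^+ 2 + c1 ^+ 2 + 1).
have den0 : 0 < 16 * K ^+ 2 + c1 ^+ 2 + 1 by lra.
have e0 : 0 < e by rewrite /e divr_gt0 ?mulr_gt0.
exists e => // s0 psi; rewrite leNgt; apply/negP => Hlt.
pose s := undup s0; have us : uniq s by apply: undup_uniq.
have {Hlt} : (l2norm2 (bulk_apply h s psi) < ((m ^+ 2 + e) * norm2_on s psi)%:E)%E.
  by move: Hlt; rewrite /bulk_apply (undup_id us).
set n0 := norm2_on s psi => Hlt.
have n00 : 0 < n0.
  rewrite lt_def norm2_on_ge0 andbT; apply/eqP => n0E.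
  move: Hlt; apply/negP; rewrite -leNgt n0E mulr0.
  by apply: esum_ge0 => x _; rewrite lee_fin vnorm2_ge0.
have en0 : 0 < e * n0 by rewrite mulr_gt0.
(* Here [f] is (H + m) psi, [phi] its truncation, [g] is (H - m) phi, and [v] the truncation of [g]
   that serves as descent direction. *)
pose f x := bulk_apply h s psi x - RtoC (- m) *: restr s psi x.
have mNK : (- m) ^+ 2 <= K ^+ 2 by rewrite sqrrN.
have fb : (l2norm2 f <= (4 * K ^+ 2 * n0)%:E)%E by apply: l2norm2_shifted_apply.
have [G1 [uG1 sG1 fG1]] := l2norm2_exhaust s fb en0.
pose phi := restr G1 f.
pose g x := bulk_apply h G1 f x - RtoC m *: phi x.
have gb : (l2norm2 g <= (4 * K ^+ 2 * norm2_on G1 f)%:E)%E.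
  exact: l2norm2_shifted_apply.
have [G2 [uG2 sG2 gG2]] := l2norm2_exhaust G1 gb en0.
pose v := restr G2 g.
pose w x := restr s psi x - RtoC (2 * K ^+ 2)^-1 *: v x.
have wb : (l2norm2 (bulk_apply h G2 w) <= (K ^+ 2 * norm2_on G2 w)%:E)%E.
  by apply: esum_le_sum => F uF; apply: norm2_on_bulk_apply.
have [G [uG sG wG]] := l2norm2_exhaust G2 wb en0.
have sG1G x : x \in G1 -> x \in G by move=> /sG2 /sG.
have ssG x : x \in s -> x \in G by move=> /sG1 /sG1G.
have vf : c2 ^+ 2 * n0 <= norm2_on G1 f + e * n0.
  rewrite -lee_fin; apply: le_trans fG1.
  by have := bNm s psi; rewrite fsnorm2_uniq.
have vg : c1 ^+ 2 * norm2_on G1 f <= norm2_on G2 g + e * n0.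
  rewrite -lee_fin; apply: le_trans gG2.
  by have := bm G1 f; rewrite fsnorm2_uniq.
have w2 : w =1 restr G2 w.
  move=> x; rewrite /restr; case: ifPn => // xG2.
  rewrite /w /v /restr (negbTE xG2) scaler0 subr0 ifF //.
  by apply: contraNF xG2 => /sG1 /sG2.
pose r x := if x \in G1 then 0 else f x.
have nr : norm2_on G r <= e * n0.
  have : norm2_on G f <= norm2_on G1 f + e * n0.
    by rewrite -lee_fin; apply: le_trans fG1; apply: norm2_on_le_l2norm2.
  have -> : norm2_on G f = norm2_on G phi + norm2_on G r.
    rewrite /norm2_on -big_split /=; apply: eq_bigr => x _.
    by rewrite /phi /r /restr; case: ifP; rewrite vnorm20 ?addr0 ?add0r.
  by rewrite norm2_on_restr // lerD2l.
have HG u : norm2_on G (bulk_apply h G u) <= K ^+ 2 * norm2_on G u.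
  exact: norm2_on_bulk_apply.
have Hu : {in G, forall x,
    bulk_apply h G (restr s psi) x + RtoC m *: restr s psi x = phi x + r x}.
  move=> x xG; rewrite bulk_apply_restr //.
  have -> : phi x + r x = f x.
    by rewrite /phi /r /restr; case: ifP; rewrite ?addr0 ?add0r.
  by rewrite /f rmorphN scaleNr opprK.
have Hphi : dot_on G (fun x => bulk_apply h G phi x - RtoC m *: phi x) v = norm2_on G v.
  rewrite /dot_on /norm2_on; apply: eq_bigr => x _.
  rewrite bulk_apply_restr // vnorm2E /v /restr; case: ifP => // _.
  by rewrite !vdot0r.
have := energy_decrease sa uG K0 mK HG Hu Hphi.
rewrite -/w !norm2_on_restr //.
have -> : norm2_on G (bulk_apply h G (restr s psi)) = norm2_on G (bulk_apply h s psi).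
  by apply: eq_bigr => x _; rewrite bulk_apply_restr.
have -> : norm2_on G (bulk_apply h G w) = norm2_on G (bulk_apply h G2 w).
  apply: eq_bigr => x _; congr vnorm2.
  rewrite -(bulk_apply_restr h w uG2 uG sG).
  by congr bulk_apply; apply/funext.
have -> : norm2_on G w = norm2_on G2 w.
  rewrite -(norm2_on_restr w uG2 uG sG).
  by apply: eq_bigr => x _; rewrite -w2.
have lowu : norm2_on G (bulk_apply h s psi) < (m ^+ 2 + e) * n0.
  by rewrite -lte_fin; apply: le_lt_trans Hlt; apply: norm2_on_le_l2norm2.
have highw : m ^+ 2 * norm2_on G2 w <= norm2_on G (bulk_apply h G2 w) + e * n0.
  rewrite -lee_fin; apply: le_trans wG.
  by have := Em G2 w; rewrite fsnorm2_uniq.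
have vbig : (c1 ^+ 2 * c2 ^+ 2 - (c1 ^+ 2 + 1) * e) * n0 <= norm2_on G2 g.
  have : c1 ^+ 2 * (c2 ^+ 2 * n0) <= c1 ^+ 2 * (norm2_on G1 f + e * n0).
    by rewrite ler_pM2l.
  by lra.
have vsmall : c1 ^+ 2 * c2 ^+ 2 - (c1 ^+ 2 + 1) * e = 16 * K ^+ 2 * e.
  by rewrite /e; field; rewrite gt_eqF.
have : 4 * (e * n0) <= norm2_on G2 g / (4 * K ^+ 2).
  rewrite ler_pdivlMr ?mulr_gt0 //; apply: le_trans vbig.
  by rewrite vsmall; lra.
rewrite -/n0; lra.
Qed.

(** Testing on a single basis vector bounds the admissible [a], so that their supremum exists. *)
Lemma energy_above_le a : energy_above a -> a <= K ^+ 2.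
Proof.
pose s := [:: 0 : int]; pose u (_ : int) : 'cV[R[i]]_2 := delta_mx ord0 ord0.
have u1 : norm2_on s u = 1 by rewrite /norm2_on big_seq1 vnorm2_delta.
have ub : (l2norm2 (bulk_apply h s u) <= (K ^+ 2)%:E)%E.
  apply: esum_le_sum => F uF.
  by apply: le_trans (norm2_on_bulk_apply u uF _) _; rewrite // u1 mulr1.
move=> /(_ s u).
by rewrite fsnorm2_uniq // u1 mulr1 => /le_trans/(_ ub); rewrite lee_fin.
Qed.

(** Let m^2 be the largest a with H^2 >= a. If m < [Delta], then m and -m both lie in the gap, and
    [energy_above_improve] contradicts maximality. *)
Lemma bulk_gap_energy_above Delta : bulk_gap h Delta -> 0 < Delta ->
  energy_above (Delta ^+ 2).
Proof.
move=> gap D0.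
have E0 : energy_above 0.
  by move=> s u; rewrite mul0r; apply: esum_ge0 => x _; rewrite lee_fin vnorm2_ge0.
pose M := [set a | energy_above a]%classic.
have supM : has_sup M by split; [exists 0|exists (K ^+ 2) => a /energy_above_le].
have m20 : 0 <= sup M by apply: ub_le_sup => //; case: supM.
pose m := Num.sqrt (sup M).
have m2 : m ^+ 2 = sup M by rewrite sqr_sqrtr.
(* The supremum is attained: for each fixed vector the condition is a closed inequality, linear in
   a. *)
have Em : energy_above (m ^+ 2).
  rewrite m2 => s u.
  have /l2norm2_fin[l l0 El] : (l2norm2 (bulk_apply h s u) <= (K ^+ 2 * fsnorm2 s u)%:E)%E.
    apply: esum_le_sum => F uF.
    have := norm2_on_bulk_apply u uF (undup_uniq s).
    by rewrite /fsnorm2 /bulk_apply undup_id ?undup_uniq.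
  rewrite El lee_fin; have [f0|fN0] := eqVneq (fsnorm2 s u) 0; first by rewrite f0 mulr0.
  have f0 : 0 < fsnorm2 s u.
    by rewrite lt_def fN0; apply: sumr_ge0 => x _; apply: vnorm2_ge0.
  rewrite -ler_pdivlMr //; apply: ge_sup; first by case: supM.
  by move=> a /(_ s u); rewrite El lee_fin ler_pdivlMr.
have mK : m ^+ 2 <= K ^+ 2 by apply: energy_above_le.
have m0 : 0 <= m by apply: sqrtr_ge0.
suff Dm : Delta <= m.
  move=> s u; apply: le_trans (Em s u); rewrite lee_fin ler_wpM2r //.
    by apply: sumr_ge0 => x _; apply: vnorm2_ge0.
  by rewrite lerXn2r // nnegrE ltW.
rewrite leNgt; apply/negP => mD.
have bb l : - Delta < l < Delta -> exists2 c, 0 < c & bounded_below_at l c.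
  by move=> /gap /contrapT[c [c0 cb]]; exists c.
have [c1 c10 b1] : exists2 c, 0 < c & bounded_below_at m c by apply: bb; lra.
have [c2 c20 b2] : exists2 c, 0 < c & bounded_below_at (- m) c by apply: bb; lra.
have [e e0 Ee] := energy_above_improve mK c10 c20 b1 b2 Em.
have : m ^+ 2 + e <= sup M by apply: ub_le_sup => //; case: supM.
by rewrite m2; lra.
Qed.

End QuantitativeGap.

(** * Elementary exponential inequalities *)

Section ExponentialBounds.
Context {R : realType}.
Implicit Types (p q z : R).

Lemma id_le_expR_half p : 0 <= p -> p <= expR (p / 2).
Proof.
move=> p0; have -> : p / 2 = p / 4 + p / 4 by field.
rewrite expRD -expr2; have e4 := expR_ge1Dx (p / 4).
apply: le_trans (_ : (1 + p / 4) ^+ 2 <= _).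
  by have := sqr_ge0 (1 - p / 4); lra.
by rewrite lerXn2r ?nnegrE ?expR_ge0 //; lra.
Qed.

Lemma expR_sub1_norm z : `|1 - expR z| <= `|z| * expR `|z|.
Proof.
have [z0|z0] := leP 0 z.
  rewrite ler0_norm; last by rewrite subr_le0 -[leLHS]expR0 ler_expR.
  rewrite opprB ger0_norm //.
  have := expR_ge1Dx (- z); rewrite expRN => h.
  have : (1 - z) * expR z <= (expR z)^-1 * expR z by rewrite ler_pM2r ?expR_gt0.
  by rewrite mulVf ?gt_eqF ?expR_gt0 //; lra.
rewrite ger0_norm; last by rewrite subr_ge0 -[leRHS]expR0 ler_expR ltW.
rewrite ltr0_norm //; apply: le_trans (_ : - z <= _).
  by have := expR_ge1Dx z; lra.
rewrite ler_peMr ?oppr_ge0 ?ltW // -[ltLHS]expR0 ltr_expR; lra.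
Qed.

(** With p = |x - y| / d and q = [mu * d], this turns an increment of the Agmon weight into the
    exponential weight of the short-range assumption, keeping the small factor q. *)
Lemma scaled_expR_le p q : 0 <= p -> 0 <= q -> q <= 1 / 2 ->
  q * p * expR (q * p) <= q * expR p.
Proof.
move=> p0 q0 q2; rewrite -mulrA ler_wpM2l //.
have -> : expR p = expR (p / 2) * expR (p / 2) by rewrite -expRD; congr expR; field.
apply: ler_pM; rewrite ?expR_ge0 // ?id_le_expR_half // ler_expR.
by rewrite mulrC ler_wpM2l; lra.
Qed.

End ExponentialBounds.

(** * Distance to the complement of the chain *)

Definition edge_dist (L : nat) (x : int) : int := Num.max 0 (Num.min (x + 1) (L%:Z - x)).

Lemma edge_dist_lip L x y : `|edge_dist L x - edge_dist L y| <= `|x - y|.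
Proof. rewrite /edge_dist. lia. Qed.

(** A pair separated by the switch has each point within |x - y| of the middle, where the distance
    to the ends is about L / 2. *)
Lemma edge_dist_mid L x y : (x < (L./2)%:Z) != (y < (L./2)%:Z) ->
  (L./2)%:Z - `|x - y| <= edge_dist L y.
Proof. rewrite /edge_dist. lia. Qed.

(** * Agmon decay of low-energy chain modes *)

Section EdgeModeDecay.
Context {R : realType}.
Local Notation RtoC := (real_complex R).
Variables (h : bulk_kernel R) (d K Delta : R) (L : nat).
Hypotheses (d0 : 0 < d) (K0 : 0 < K) (Delta0 : 0 < Delta).
Hypotheses (sa : bulk_selfadjoint h) (sr : short_range h d K) (gap : bulk_gap h Delta).

Definition chain_sites : seq int := [seq n%:Z | n <- iota 0 L].

Let s := chain_sites.
(** The decay rate is tuned so that [mu * d * K] is the fixed fraction [Delta / 8] of the gap. *)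
Let mu : R := Delta / (8 * d * K).
Let f : int -> int := edge_dist L.
Let weight x : R := expR (mu * (f x)%:~R).

Lemma chain_sites_uniq : uniq chain_sites.
Proof. by rewrite map_inj_uniq ?iota_uniq // => x y []. Qed.

Lemma mem_chain_sites x : (x \in chain_sites) = (0 <= x < L%:Z).
Proof.
apply/mapP/idP => [[n]|]; first by rewrite mem_iota => h1 ->; lia.
by case: x => // n h1; exists n => //; rewrite mem_iota; lia.
Qed.

Let us : uniq s. Proof. exact: chain_sites_uniq. Qed.

Let f_out x : x \notin s -> f x = 0.
Proof. by rewrite mem_chain_sites /f /edge_dist; lia. Qed.

(** H^2 is at least Delta^2 by the gap and at most K^2 by the range. This yields
    [mu * d <= 1 / 8]. *)
Lemma gap_le_range : Delta <= K.
Proof.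
have := energy_above_le d0 sa sr (bulk_gap_energy_above d0 K0 sa sr gap Delta0).
by rewrite ler_pXn2r // nnegrE ltW.
Qed.

Let mud : mu * d = Delta / (8 * K).
Proof. by rewrite /mu; field; rewrite !gt_eqF. Qed.

Let mud_le : mu * d <= 1 / 8.
Proof.
rewrite mud ler_pdivrMr ?mulr_gt0 //.
by have := gap_le_range; lra.
Qed.

Let mu0 : 0 < mu. Proof. by rewrite divr_gt0 ?mulr_gt0. Qed.

Let dist_ge0 (x y : int) : 0 <= (`|x - y|%:~R / d : R).
Proof. by apply: divr_ge0; [rewrite ler0z|exact: ltW]. Qed.

Let mu_dist (x y : int) : mu * (`|x - y|%:~R : R) = (mu * d) * (`|x - y|%:~R / d).
Proof. by field; rewrite gt_eqF. Qed.

Let far (x y : int) : x != y -> d^-1 <= (`|x - y|%:~R / d : R).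
Proof.
move=> xy; rewrite ler_peMl ?invr_ge0 ?(ltW d0) //.
by rewrite -[leLHS]mulr1z ler_int; lia.
Qed.

Lemma weight_kernel_bound x y :
  `|1 - weight x / weight y| <= mu * d * expR (`|x - y|%:~R / d).
Proof.
rewrite /weight -expRN -expRD -mulrN -mulrDr -rmorphN -rmorphD /=.
apply: le_trans (expR_sub1_norm _) _.
rewrite normrM [`|mu|]gtr0_norm // -intr_norm.
have lip : (`|f x - f y|%:~R : R) <= `|x - y|%:~R by rewrite ler_int edge_dist_lip.
apply: le_trans (_ : mu * `|x - y|%:~R * expR (mu * `|x - y|%:~R) <= _).
  apply: ler_pM; rewrite ?expR_ge0 ?ler_expR ?ler_pM2l ?pmulr_rge0 ?ler0z //.
rewrite mu_dist; apply: scaled_expR_le => //; first by rewrite mulr_ge0 ?ltW.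
by move: mud_le; lra.
Qed.

(** Distinct sites are at distance at least 1. The factor [d] gained here makes the leak of size
    [d * K], so that all final errors depend on [d * K / Delta], a ratio controlled by [L]. *)
Lemma far_kernel_bound (x y : int) : x != y -> 1 <= d * expR (`|x - y|%:~R / d).
Proof.
move=> xy; rewrite -ler_pdivrMl // mulr1.
apply: le_trans (far xy) _.
by have := expR_ge1Dx (`|x - y|%:~R / d : R); lra.
Qed.

Let th (x : int) : R := if x < (L./2)%:Z then 1 else 0.

Lemma commutator_kernel_bound x y :
  `|(th x - th y) / weight y| <=
    2 * d * expR (- (mu * (L./2)%:R)) * expR (`|x - y|%:~R / d).
Proof.
have [same|diff] := eqVneq (x < (L./2)%:Z) (y < (L./2)%:Z).
  rewrite /th same subrr mul0r normr0 !mulr_ge0 ?expR_ge0 ?ltW //.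
have xy : x != y by apply: contraNneq diff => ->.
have -> : `|(th x - th y) / weight y| = (weight y)^-1.
  rewrite normrM [X in _ * X]gtr0_norm ?invr_gt0 ?expR_gt0 // /th.
  by case: ifP diff; case: ifP => //; rewrite ?subr0 ?sub0r ?normrN normr1 mul1r.
rewrite /weight -expRN.
have mid : ((L./2)%:R : R) - `|x - y|%:~R <= (f y)%:~R.
  by rewrite -[_%:R]/((L./2)%:Z%:~R) -rmorphB ler_int edge_dist_mid.
apply: le_trans (_ : expR (- (mu * (L./2)%:R)) * expR (mu * `|x - y|%:~R) <= _).
  by rewrite -expRD ler_expR; move: mid; rewrite -(ler_pM2l mu0) mulrBr; lra.
set A := expR (- _); set p : R := `|x - y|%:~R / d.
(* One half of the exponent p absorbs the loss [mu * |x - y|] in the weight; the other half gives 1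
   <= 2 d exp(p / 2), since p >= 1 / d. *)
have -> : 2 * d * A * expR p = A * (expR (p / 2) * (expR (p / 2) * (2 * d))).
  have -> : expR p = expR (p / 2) * expR (p / 2) by rewrite -expRD; congr expR; field.
  by ring.
rewrite ler_wpM2l ?expR_ge0 // -[leLHS]mulr1; apply: ler_pM; rewrite ?expR_ge0 //.
  by rewrite ler_expR mu_dist mulrC ler_wpM2l //; move: mud_le; lra.
rewrite -ler_pdivrMr ?mulr_gt0 // mul1r.
have := expR_ge1Dx (p / 2); have := far xy.
by rewrite -/p invfM; lra.
Qed.

Variables (E : R) (psi : int -> 'cV[R[i]]_2).
Hypotheses (E_low : `|E| <= 3 / 4 * Delta) (psi1 : norm2_on s psi = 1).
Hypothesis psiE : {in s, forall x, bulk_apply h s psi x = RtoC E *: psi x}.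

Let phi x : 'cV[R[i]]_2 := RtoC (weight x) *: psi x.

Let psi_phi y : psi y = RtoC (weight y)^-1 *: phi y.
Proof.
by rewrite /phi scalerA -rmorphM mulVf ?scale1r // gt_eqF ?expR_gt0.
Qed.

(* Agmon's estimate: conjugating by the weight perturbs the bulk operator by at
   most [mu * d * K = Delta / 8], and the cut at the ends of the chain is the only
   source term since the weight is 1 outside. *)
Lemma weighted_norm_le : norm2_on s phi <= (8 * (d * K / Delta)) ^+ 2.
Proof.
pose D x := \sum_(y <- s) RtoC (1 - weight x / weight y) *: (h x y *m phi y).
pose leak x := \sum_(y <- s) RtoC ((x \notin s) && (y \in s))%:R *: (h x y *m psi y).
(* [D] is the commutator with the weight applied to [phi], and [leak] is the part of H psi outside
   the chain, where the weight is 1. *)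
have decomp x : bulk_apply h s phi x = RtoC E *: restr s phi x + (leak x + D x).
  have -> : bulk_apply h s phi x = RtoC (weight x) *: bulk_apply h s psi x + D x.
    rewrite /bulk_apply undup_id // /D scaler_sumr -big_split /=.
    apply: eq_bigr => y _; rewrite [in LHS](_ : h x y *m phi y =
      RtoC (weight x / weight y + (1 - weight x / weight y)) *: (h x y *m phi y)).
      rewrite rmorphD scalerDl; congr (_ + _).
      by rewrite /phi -scalemxAr scalerA -rmorphM divfK // gt_eqF ?expR_gt0.
    by rewrite subrKC scale1r.
  rewrite addrA; congr (_ + _); rewrite /restr; case: ifPn => xs.
    rewrite psiE // scalerA mulrC -scalerA -/(phi x) /leak big1 ?addr0 // => y _.
    by rewrite xs scale0r.
  rewrite scaler0 add0r /weight f_out // mulr0 expR0 scale1r.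
  rewrite /bulk_apply undup_id //; apply: eq_big_seq => y ys.
  by rewrite xs ys scale1r.
set P := norm2_on s phi.
have P0 : 0 <= P by apply: norm2_on_ge0.
have leakF F : uniq F -> norm2_on F leak <= (d * K) ^+ 2.
  move=> uF; rewrite -[leRHS]mulr1 -psi1.
  apply: (schur_test sa sr) => //; first exact: ltW.
  move=> x y; case: (boolP (x \in s)) => xs /=.
    by rewrite normr0 mulr_ge0 ?expR_ge0 // ltW.
  case: (boolP (y \in s)) => ys; last by rewrite normr0 mulr_ge0 ?expR_ge0 // ltW.
  by rewrite normr1 far_kernel_bound //; apply: contraNneq xs => ->.
have DF F : uniq F -> norm2_on F D <= (Delta / 8) ^+ 2 * P.
  move=> uF; have -> : Delta / 8 = mu * d * K by rewrite mud; field; rewrite gt_eqF.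
  apply: (schur_test sa sr) => //; last exact: weight_kernel_bound.
  by rewrite mulr_ge0 ?ltW.
have E2 : E ^+ 2 <= (3 / 4 * Delta) ^+ 2.
  rewrite -[E ^+ 2]real_normK ?num_real // lerXn2r ?nnegrE //.
  by rewrite mulr_ge0 ?ltW // divr_gt0.
(* From |a + b + c|^2 <= 4/3 |a|^2 + 8 |b|^2 + 8 |c|^2. The coefficient of Delta^2 P is 4/3 * 9/16 +
   8/64 = 7/8, so the lower bound [low] leaves Delta^2 P / 8 <= 8 (d K)^2. *)
have up F : uniq F -> norm2_on F (bulk_apply h s phi) <=
    4 / 3 * (3 / 4 * Delta) ^+ 2 * P + 8 * (d * K) ^+ 2 + 8 * ((Delta / 8) ^+ 2 * P).
  move=> uF; have := leakF F uF; have := DF F uF.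
  have : E ^+ 2 * norm2_on F (restr s phi) <= (3 / 4 * Delta) ^+ 2 * P.
    by apply: ler_pM; rewrite ?sqr_ge0 ?norm2_on_ge0 ?norm2_on_restr_le.
  have : norm2_on F (bulk_apply h s phi) <= 4 / 3 * (E ^+ 2 * norm2_on F (restr s phi))
      + 8 * norm2_on F leak + 8 * norm2_on F D.
    rewrite /norm2_on !mulr_sumr -!big_split /=; apply: ler_sum => x _.
    rewrite decomp; set a := restr s phi x; set b := leak x; set c := D x.
    have := vnorm2_ge0 (RtoC E *: a + RtoC (- 3) *: (b + c)).
    have := vnorm2_ge0 (b + RtoC (- 1) *: c).
    rewrite !vnorm2D !vnorm2Z !vdotZr !vdotZl vnorm2D; lra.
  lra.
have low : Delta ^+ 2 * P <=
    4 / 3 * (3 / 4 * Delta) ^+ 2 * P + 8 * (d * K) ^+ 2 + 8 * ((Delta / 8) ^+ 2 * P).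
  rewrite -lee_fin.
  have := bulk_gap_energy_above d0 K0 sa sr gap Delta0 s phi.
  rewrite fsnorm2_uniq // => /le_trans; apply.
  exact: esum_le_sum.
rewrite exprMn expr_div_n mulrA ler_pdivlMr ?exprn_gt0 //; lra.
Qed.

(** Writing psi as phi divided by the weight moves the decay into the kernel, where Schur's test
    applies; the bound on |phi| supplies the factor 8 d K / Delta. *)
Lemma commutator_decay :
  norm2_on s (fun x => \sum_(y <- s) RtoC (th x - th y) *: (h x y *m psi y)) <=
    (16 * (d * K) ^+ 2 / Delta * expR (- (mu * (L./2)%:R))) ^+ 2.
Proof.
have -> : norm2_on s (fun x => \sum_(y <- s) RtoC (th x - th y) *: (h x y *m psi y)) =
    \sum_(x <- s) vnorm2 (\sum_(y <- s)
       RtoC ((th x - th y) / weight y) *: (h x y *m phi y)).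
  apply: eq_bigr => x _; congr vnorm2; apply: eq_bigr => y _.
  by rewrite psi_phi -scalemxAr scalerA -rmorphM.
apply: le_trans (schur_test sa sr phi _ commutator_kernel_bound us us) _.
  by rewrite !mulr_ge0 ?expR_ge0 ?ltW.
apply: le_trans (ler_wpM2l (sqr_ge0 _) weighted_norm_le) _.
rewrite -exprMn le_eqVlt; apply/orP; left; apply/eqP; congr (_ ^+ 2).
by field; rewrite gt_eqF.
Qed.

End EdgeModeDecay.

(** * The open chain as a matrix and as a field of blocks *)

Section OpenChain.
Context {R : realType}.
Local Notation RtoC := (real_complex R).
Variable L : nat.

Lemma sum_site_spin (V : nmodType) (F : nat -> 'I_2 -> V) :
  \sum_(i < L * 2) F (site i) (spin i) = \sum_(0 <= n < L) \sum_a F n a.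
Proof.
rewrite /site /spin.
rewrite -(big_mkord xpredT (fun i : nat => F (i %/ 2)%N (inord (i %% 2)))).
elim: L => [|l IH]; first by rewrite !big_geq.
rewrite mulSn add2n !big_nat_recr //= IH -addrA; congr (_ + _).
rewrite big_ord_recl big_ord1 modnMl mulnK // -[(l * 2).+1]addn1 divnMDl // addn0 modnMDl.
by congr (F l _ + F l _); apply: val_inj; rewrite /= inordK.
Qed.

(* Junk when [x] is not a site of the chain. *)
Definition chain_field (v : 'cV[R[i]]_(L * 2)) (x : int) : 'cV[R[i]]_2 :=
  \col_a (if insub (`|x| * 2 + a)%N is Some i then v i ord0 else 0).

Lemma chain_fieldE v i : chain_field v (site i)%:Z (spin i) ord0 = v i ord0.
Proof.
rewrite mxE /site /spin inordK ?ltn_mod // absz_nat -divn_eq.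
by rewrite valK.
Qed.

Lemma chain_site_spin n (a : 'I_2) : (n < L)%N -> exists2 i : 'I_(L * 2), site i = n & spin i = a.
Proof.
move=> nL; have iL : (n * 2 + a < L * 2)%N by have := ltn_ord a; lia.
exists (Ordinal iL); first by rewrite /site /= divnMDl // divn_small // addn0.
by apply: val_inj; rewrite /= inordK ?ltn_mod // modnMDl modn_small.
Qed.

Lemma norm2_on_chain_field v : norm2_on (chain_sites L) (chain_field v) = vnorm2 v.
Proof.
rewrite /norm2_on /chain_sites big_map.
rewrite [RHS](eq_bigr (fun i => cabs2 (chain_field v (site i)%:Z (spin i) ord0))); last first.
  by move=> i _; rewrite chain_fieldE.
rewrite (sum_site_spin (fun n a => cabs2 (chain_field v n%:Z a ord0))).
by rewrite /index_iota subn0.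
Qed.

Lemma chain_field_kernel (k : int -> int -> 'M[R[i]]_2) (A : 'M[R[i]]_(L * 2)) v :
  (forall i j, A i j = k (site i)%:Z (site j)%:Z (spin i) (spin j)) ->
  {in chain_sites L, forall x,
    chain_field (A *m v) x = \sum_(y <- chain_sites L) k x y *m chain_field v y}.
Proof.
move=> Ak _ /mapP[n + ->]; rewrite mem_iota /= add0n => nL.
apply/colP => a; have [i <- <-] := chain_site_spin a nL.
rewrite chain_fieldE mxE /chain_sites big_map summxE.
rewrite (eq_bigr (fun j => k (site i)%:Z (site j)%:Z (spin i) (spin j) *
    chain_field v (site j)%:Z (spin j) ord0)); last first.
  by move=> j _; rewrite chain_fieldE Ak.
rewrite (sum_site_spin (fun n a => k (site i)%:Z n%:Z (spin i) a *
    chain_field v n%:Z a ord0)) /index_iota subn0.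
by apply: eq_bigr => m _; rewrite mxE.
Qed.

Variables (h : bulk_kernel R) (d K Delta : R).
Hypotheses (d0 : 0 < d) (K0 : 0 < K) (Delta0 : 0 < Delta).
Hypotheses (sa : bulk_selfadjoint h) (sr : short_range h d K) (gap : bulk_gap h Delta).
Local Notation H := (chain_restrict h L).
Local Notation Th := (thetaX R L).

Lemma chain_commutator_decay (E : R) (v : 'cV[R[i]]_(L * 2)) :
  `|E| <= 3 / 4 * Delta -> vnorm2 v = 1 -> H *m v = RtoC E *: v ->
  vnorm2 ((Th *m H - H *m Th) *m v) <=
    (16 * (d * K) ^+ 2 / Delta * expR (- (Delta / (8 * d * K) * (L./2)%:R))) ^+ 2.
Proof.
move=> El v1 Hv.
have n1 : norm2_on (chain_sites L) (chain_field v) = 1 by rewrite norm2_on_chain_field.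
have eigen : {in chain_sites L, forall x,
    bulk_apply h (chain_sites L) (chain_field v) x = RtoC E *: chain_field v x}.
  move=> x xs; rewrite /bulk_apply undup_id ?chain_sites_uniq //.
  rewrite -(chain_field_kernel (A := H)) // => [|i j]; last by rewrite mxE.
  rewrite Hv; apply/colP => a; rewrite !mxE.
  by case: insub => [i|]; rewrite ?mxE // mulr0.
apply: le_trans (commutator_decay d0 K0 Delta0 sa sr gap El n1 eigen).
rewrite -norm2_on_chain_field le_eqVlt; apply/orP; left; apply/eqP.
apply: eq_big_seq => x xs; congr vnorm2.
pose th (x : int) : R := if x < (L./2)%:Z then 1 else 0.
(* The commutator of the switch with H has the block kernel (th x - th y) h x y. *)
rewrite (chain_field_kernel (k := fun x y => RtoC (th x - th y) *: h x y)) //.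
  by apply: eq_bigr => y _; rewrite scalemxAl.
move=> i j; rewrite /thetaX mul_diag_mx mul_mx_diag !mxE.
have thE (m : nat) : theta R L m = RtoC (th m%:Z).
  by rewrite /theta /th ltz_nat; case: ifP.
by rewrite !thE rmorphB mulrBl [X in _ - X]mulrC.
Qed.

End OpenChain.

(** * Bounds on the hyperbolic tangent *)

Section Tanh.
Context {R : realType}.
Implicit Types u : R.

Let den_gt0 u : 0 < expR u + expR (- u).
Proof. by rewrite addr_gt0 ?expR_gt0. Qed.

Lemma tanhN u : tanh (- u) = - tanh u.
Proof. by rewrite /tanh opprK -[RHS]mulNr opprB [X in _ / X]addrC. Qed.

Lemma one_sub_tanh2 u : 1 - tanh u ^+ 2 = 4 / (expR u + expR (- u)) ^+ 2.
Proof.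
have e1 : expR u * expR (- u) = 1 by rewrite expRxMexpNx_1.
have dN0 : expR u + expR (- u) != 0 by rewrite gt_eqF.
rewrite /tanh; move: e1 dN0; set p := expR u; set q := expR (- u) => e1 dN0.
have -> : 4 / (p + q) ^+ 2 = 4 * (p * q) / (p + q) ^+ 2 by rewrite e1 mulr1.
by field.
Qed.

Lemma one_sub_tanh2_ge0 u : 0 <= 1 - tanh u ^+ 2.
Proof. by rewrite one_sub_tanh2 divr_ge0 // sqr_ge0. Qed.

Lemma one_sub_tanh2_le u : 1 - tanh u ^+ 2 <= 4 * expR (- (2 * `|u|)).
Proof.
rewrite one_sub_tanh2 ler_wpM2l // [leRHS]expRN lef_pV2 ?posrE ?expR_gt0 ?exprn_gt0 //.
have -> : 2 * `|u| = `|u| + `|u| by ring.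
rewrite expRD -expr2 lerXn2r ?nnegrE ?expR_ge0 ?(ltW (den_gt0 u)) //.
by have [u0|u0] := ger0P u; rewrite ?lerDl ?lerDr expR_ge0.
Qed.

(** A linear bound is what is wanted: it is paired later with the estimate of |X_ii| |D_i|, which is
    linear in D_i. *)
Lemma tanh2_le u : tanh u ^+ 2 <= 2 * `|u|.
Proof.
wlog u0 : u / 0 <= u => [hw|].
  have [/hw //|/ltW u0] := leP 0 u.
  by rewrite -sqrrN -tanhN -normrN; apply: hw; rewrite oppr_ge0.
rewrite ger0_norm //.
have t0 : 0 <= tanh u.
  rewrite divr_ge0 ?(ltW (den_gt0 u)) // subr_ge0 ler_expR; lra.
have t1 : tanh u <= 1.
  by rewrite ler_pdivrMr // mul1r; have := expR_ge0 (- u); lra.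
apply: le_trans (_ : tanh u <= _); first by rewrite expr2 ler_piMl.
rewrite ler_pdivrMr //.
have e1 : expR (- u) = expR (- (2 * u)) * expR u by rewrite -expRD; congr expR; ring.
have := expR_ge1Dx (- (2 * u)); set q := expR (- u) in e1 *.
have q0 : 0 <= q by apply: expR_ge0.
have p0 : 0 < expR u by apply: expR_gt0.
move=> le1; have : (1 + - (2 * u)) * expR u <= q by rewrite e1 ler_pM2r.
have : 0 <= u * q by rewrite mulr_ge0.
by lra.
Qed.

End Tanh.

(** * Hermitian matrices close to their cube *)

Section NearlyIntegerTrace.
Context {R : realType}.
Local Notation RtoC := (real_complex R).

(** In x^3 - x = (x - 1) x (x + 1), cut the line at -1/2 and 1/2: in each piece the two factors
    other than the nearest root have product at least 3/4 in modulus. *)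
Lemma near_integer_of_cubic (x e : R) : `|x ^+ 3 - x| <= e ->
  exists k : int, `|x - k%:~R| <= 2 * e.
Proof.
have key (k y : R) : 3 / 4 <= `|y| -> `|(x - k) * y| <= e -> `|x - k| <= 2 * e.
  move=> y34; rewrite normrM => he.
  have : `|x - k| * (3 / 4) <= `|x - k| * `|y| by rewrite ler_wpM2l.
  by have := normr_ge0 (x - k); lra.
move=> he; have [x1|x1] := leP x (1 / 2); last first.
  exists 1; apply: (key _ (x * (x + 1))); last first.
    by rewrite (_ : _ * _ = x ^+ 3 - x) //; ring.
  by rewrite ger0_norm; nra.
have [x2|x2] := leP (- (1 / 2)) x.
  exists 0; apply: (key _ (x ^+ 2 - 1)); last first.
    by rewrite (_ : _ * _ = x ^+ 3 - x) //; ring.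
  by rewrite ler0_norm; nra.
exists (-1); apply: (key _ (x * (x - 1))); last first.
  by rewrite (_ : _ * _ = x ^+ 3 - x) //; rewrite mulrN1z; ring.
by rewrite ger0_norm; nra.
Qed.

Lemma unitary_entry_le1 n (U : 'M[R[i]]_n) i j :
  mxstar U *m U = 1%:M -> cabs (U i j) <= 1.
Proof.
move=> UU; rewrite -sqrtr1 /cabs ler_wsqrtr //.
have := cabs2_le_vnorm2 (U *m delta_mx j ord0) i.
by rewrite vnorm2_unitary // vnorm2_delta -colE mxE.
Qed.

Lemma hermitian_diagonalize n (B : 'M[R[i]]_n) : mxstar B = B ->
  exists (P : 'M[R[i]]_n) (D : 'rV[R]_n),
    [/\ P *m mxstar P = 1%:M, mxstar P *m P = 1%:M &
        B = mxstar P *m diag_mx (map_mx RtoC D) *m P].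
Proof.
move=> Bh.
have Bherm : B \is hermsymmx.
  by apply/is_hermitianmxP; rewrite expr0 scale1r -{1}Bh.
have PP : spectralmx B *m mxstar (spectralmx B) = 1%:M.
  exact/unitarymxP/spectral_unitarymx.
have PP' := mulmx1C PP.
exists (spectralmx B), (map_mx (@complex.Re R) (spectral_diag B)); split => //.
have /orthomx_spectralP {1}-> := hermitian_normalmx Bherm.
rewrite (invmx_unitary (spectral_unitarymx B)); congr (_ *m diag_mx _ *m _).
apply/rowP => i; rewrite !mxE RRe_real //.
by have /mxOverP := hermitian_spectral_diag_real Bherm; apply.
Qed.

(** In an eigenbasis, B^3 - B is diagonal with entries D_i^3 - D_i. Entries of a unitary matrix have
    modulus at most 1, so the change of basis costs n^2; the sum over eigenvalues costs another
    n. *)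
Lemma trace_near_integer n (B : 'M[R[i]]_n) (e : R) : mxstar B = B ->
  (forall i j, cabs ((B *m B *m B - B) i j) <= e) ->
  exists k : int, cabs (\tr B - k%:~R) <= 2 * n%:R ^+ 3 * e.
Proof.
move=> Bh Be; have [P [D [PP PP' BE]]] := hermitian_diagonalize Bh.
have diagE : diag_mx (map_mx RtoC D) = P *m B *m mxstar P.
  by rewrite BE !mulmxA PP mul1mx -mulmxA PP mulmx1.
have cubic i : `|D ord0 i ^+ 3 - D ord0 i| <= n%:R ^+ 2 * e.
  pose E := B *m B *m B - B; set Dm := diag_mx _ in diagE.
  have DE : Dm *m Dm *m Dm - Dm = P *m E *m mxstar P.
    rewrite diagE !mulmxA -!(mulmxA _ (mxstar P) P) PP' !mulmx1.
    by rewrite -(mulmxA P B B) -(mulmxA P (B *m B) B) -mulmxBl -mulmxBr.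
  have -> : `|D ord0 i ^+ 3 - D ord0 i| = cabs ((P *m E *m mxstar P) i i).
    rewrite -DE -cabs_real /Dm !mulmx_diag !mxE eqxx !mulr1n.
    by rewrite -!rmorphM -rmorphB exprS expr2 mulrA.
  rewrite mxE; apply: le_trans (ler_cabs_sum _ _ _) _.
  have -> : n%:R ^+ 2 * e = \sum_(k < n) \sum_(j < n) e.
    by rewrite !sumr_const !card_ord -mulrnA -[RHS]mulr_natl natrM expr2.
  apply: ler_sum => k _; rewrite cabsM mxstarE cabs_conj.
  apply: le_trans (_ : cabs ((P *m E) i k) <= _).
    by rewrite ler_piMr ?cabs_ge0 ?unitary_entry_le1.
  rewrite mxE; apply: le_trans (ler_cabs_sum _ _ _) _; apply: ler_sum => j _.
  rewrite cabsM; apply: le_trans (Be j k).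
  by rewrite ler_piMl ?cabs_ge0 ?unitary_entry_le1.
have /choice[k kD] : forall i, exists k : int,
    `|D ord0 i - k%:~R| <= 2 * (n%:R ^+ 2 * e).
  by move=> i; apply: near_integer_of_cubic.
exists (\sum_i k i).
have -> : \tr B = \sum_i RtoC (D ord0 i).
  rewrite BE mxtrace_mulC mulmxA PP mul1mx mxtrace_diag.
  by apply: eq_bigr => i _; rewrite mxE.
rewrite rmorph_sum -sumrB; apply: le_trans (ler_cabs_sum _ _ _) _.
have -> : 2 * n%:R ^+ 3 * e = \sum_(i < n) 2 * (n%:R ^+ 2 * e).
  by rewrite sumr_const card_ord -[RHS]mulr_natl; ring.
apply: ler_sum => i _; apply: le_trans (kD i).
by rewrite /= -(rmorph_int (real_complex R)) -rmorphB cabs_real.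
Qed.

End NearlyIntegerTrace.

(** Pigeonhole: the n + 1 half-open windows are disjoint, so choosing a point in each would inject
    ['I_n.+1] into ['I_n]. *)
Lemma spectral_window_gap (R : realType) n (a : 'I_n -> R) (b w : R) : 0 < w ->
  exists j : 'I_n.+1, forall i, a i <= b + j%:R * w \/ b + (j%:R + 1) * w < a i.
Proof.
move=> w0; apply: contrapT => /forallNP none.
have /choice[f fP] : forall j : 'I_n.+1, exists i, b + j%:R * w < a i <= b + (j%:R + 1) * w.
  move=> j; have /existsNP[i /not_orP[/negP lo /negP hi]] := none j.
  by exists i; rewrite ltNge lo leNgt hi.
have f_lt (j k : 'I_n.+1) : (j < k)%N -> f j <> f k.
  move=> jk fjk; have /andP[_ hj] := fP j; have /andP[hk _] := fP k.
  have jk' : (j%:R + 1) * w <= k%:R * w by rewrite ler_wpM2r ?(ltW w0) // natr1 ler_nat.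
  by move: hj hk; rewrite fjk; lra.
have f_inj : injective f.
  move=> j k fjk; apply: val_inj.
  by case: (ltngtP j k) => // /f_lt; rewrite fjk.
by have := leq_card f f_inj; rewrite !card_ord ltnn.
Qed.

(** * Traces over a low-energy window *)

Section LowEnergyTrace.
Context {R : realType}.
Local Notation RtoC := (real_complex R).
Variables (n : nat) (X : 'M[R[i]]_n) (D : 'I_n -> R) (e delta Delta : R).
Hypotheses (e0 : 0 <= e) (delta0 : 0 < delta) (Delta0 : 0 < Delta).
Hypotheses (Xh : mxstar X = X) (X3 : X *m X *m X = X).
Hypothesis (X1 : forall i j, cabs (X i j) <= 1).
Hypothesis X_anticomm : forall i j, `|D j| <= 3 / 4 * Delta ->
  cabs (X i j) * `|D i + D j| <= e.

(* [X] almost commutes with the projection [P] onto the low-energy window, so [P X P]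
   inherits [X^3 = X] approximately and its trace is almost an integer. *)
Lemma low_energy_trace_near_integer : exists (low : pred 'I_n) (k : int),
  [/\ forall i, low i -> `|D i| <= 3 / 4 * Delta,
      forall i, ~~ low i -> Delta / 2 <= `|D i| &
      cabs (\sum_(i | low i) X i i - k%:~R) <= 8 * n%:R ^+ 5 * n.+1%:R * e / Delta].
Proof.
(* The n + 1 windows of this width exactly fill the interval from Delta / 2 to 3 Delta / 4. *)
pose w := Delta / (4 * n.+1%:R).
have w0 : 0 < w by rewrite divr_gt0 // mulr_gt0 // ltr0n.
have [j jgap] := spectral_window_gap (fun i => `|D i|) (Delta / 2) w0.
pose low i := `|D i| <= Delta / 2 + j%:R * w.
have jw0 : 0 <= j%:R * w by rewrite mulr_ge0 ?ler0n ?(ltW w0).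
have jw : j%:R * w <= Delta / 4.
  have -> : Delta / 4 = n.+1%:R * w by rewrite /w; field; rewrite nat1r pnatr_eq0.
  by rewrite ler_wpM2r ?(ltW w0) // ler_nat ltnW.
have lowE i : low i -> `|D i| <= 3 / 4 * Delta by rewrite /low; lra.
pose B : 'M[R[i]]_n := \matrix_(a, b) (if low a && low b then X a b else 0).
have Bh : mxstar B = B.
  apply/matrixP => a b; rewrite mxstarE !mxE andbC.
  by case: ifP => _; rewrite ?conjc0 // -mxstarE Xh.
(* Across the empty window |D_a + D_b| >= |D_a| - |D_b| > w, so dividing the anticommutator bound by
   w is allowed. *)
have mixed a b : ~~ low a -> low b -> cabs (X a b) <= e / w.
  move=> na lb; rewrite ler_pdivlMr //.
  apply: le_trans (X_anticomm a (lowE b lb)); rewrite ler_wpM2l ?cabs_ge0 //.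
  have [//|hi] := jgap a; first by move: na; rewrite /low => /negbTE ->.
  have := ler_normB (D a + D b) (D b); rewrite addrK.
  by move: lb hi; rewrite /low; lra.
have mixedC a b : low a -> ~~ low b -> cabs (X a b) <= e / w.
  by move=> la nb; rewrite -Xh mxstarE cabs_conj mixed.
have Bcube a b : cabs ((B *m B *m B - B) a b) <= n%:R ^+ 2 * (e / w).
  have ew0 : 0 <= e / w by rewrite divr_ge0 // ltW.
  have cubeE (M : 'M[R[i]]_n) : (M *m M *m M) a b =
      \sum_(l < n) \sum_(k < n) M a k * M k l * M l b.
    by rewrite mxE; apply: eq_bigr => l _; rewrite mxE mulr_suml.
  have BE c c' : B c c' = if low c && low c' then X c c' else 0 by rewrite mxE.
  have -> : (B *m B *m B - B) a b = (B *m B *m B) a b - B a b.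
    by rewrite mxE [X in _ + X]mxE.
  rewrite cubeE BE; have [/andP[la lb]|nab] := boolP (low a && low b); last first.
    rewrite subr0 big1 ?cabs0 ?(mulr_ge0 (sqr_ge0 _)) // => l _; rewrite big1 // => k _.
    rewrite !BE; case la: (low a) nab => /=; last by rewrite !mul0r.
    by move=> /negbTE ->; rewrite andbF mulr0.
  (* Replacing the entry of X by that of X^3 cancels every path through two low indices; each
     remaining term contains an entry of X between low and high. *)
  have -> : \sum_(l < n) \sum_(k < n) B a k * B k l * B l b - X a b =
      \sum_(l < n) \sum_(k < n)
        (if low k && low l then 0 else - (X a k * X k l * X l b)).
    rewrite -[in X a b]X3 cubeE -sumrB; apply: eq_bigr => l _.
    rewrite -sumrB; apply: eq_bigr => k _; rewrite !BE la lb andbT /=.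
    by case: (low k); case: (low l); rewrite /= ?mulr0 ?mul0r ?subrr ?sub0r.
  apply: le_trans (ler_cabs_sum _ _ _) _.
  have -> : n%:R ^+ 2 * (e / w) = \sum_(l < n) \sum_(k < n) (e / w).
    by rewrite !sumr_const !card_ord -mulrnA -[RHS]mulr_natl natrM expr2.
  apply: ler_sum => l _; apply: le_trans (ler_cabs_sum _ _ _) _; apply: ler_sum => k _.
  case: ifPn => [_|nkl]; first by rewrite cabs0.
  rewrite cabsN !cabsM; have [lk|nk] := boolP (low k).
    have nl : ~~ low l by move: nkl; rewrite lk.
    apply: le_trans (mixedC _ _ lk nl).
    rewrite -mulrA -[leRHS]mul1r; apply: ler_pM; rewrite ?mulr_ge0 ?cabs_ge0 ?X1 //.
    by rewrite ler_piMr ?cabs_ge0.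
  apply: le_trans (mixedC _ _ la nk).
  rewrite -mulrA ler_piMr ?cabs_ge0 // -[leRHS]mul1r.
  by apply: ler_pM; rewrite ?cabs_ge0.
have [k kP] := trace_near_integer Bh Bcube.
exists low, k; split => //; first by move=> i; rewrite /low -ltNge; lra.
have -> : \sum_(i | low i) X i i = \tr B.
  by rewrite /mxtrace [LHS]big_mkcond; apply: eq_bigr => i _; rewrite mxE andbb.
apply: le_trans kP _; rewrite le_eqVlt; apply/orP; left; apply/eqP.
rewrite /w; field; rewrite gt_eqF //= nat1r pnatr_eq0 //.
Qed.

(** The sum splits into high energies, where 1 - tanh^2 is exponentially small, the low-energy
    trace, and a tanh^2 correction at low energies, controlled by the diagonal case of
    [X_anticomm]. *)
Lemma index_near_integer : exists k : int,
  cabs (\sum_i X i i * RtoC (1 - tanh (D i / delta) ^+ 2) - k%:~R) <=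
    4 * n%:R * expR (- (Delta / delta)) + n%:R * e / delta
    + 8 * n%:R ^+ 5 * n.+1%:R * e / Delta.
Proof.
have [low [k [lowE highE kP]]] := low_energy_trace_near_integer.
exists k.
rewrite (bigID low) /=.
have -> : \sum_(i | low i) X i i * RtoC (1 - tanh (D i / delta) ^+ 2) =
    \sum_(i | low i) X i i - \sum_(i | low i) X i i * RtoC (tanh (D i / delta) ^+ 2).
  by rewrite -sumrB; apply: eq_bigr => i _; rewrite rmorphB mulrBr mulr1.
set high := \sum_(i | ~~ low i) _; set corr := \sum_(i | low i) X i i * _.
set tr := \sum_(i | low i) _.
have -> : tr - corr + high - k%:~R = (high + - corr) + (tr - k%:~R) by ring.
apply: le_trans (ler_cabsD _ _) _; apply: lerD => //.
apply: le_trans (ler_cabsD _ _) _; rewrite cabsN; apply: lerD.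
  apply: le_trans (ler_cabs_sum _ _ _) _.
  apply: le_trans (_ : \sum_(i < n) 4 * expR (- (Delta / delta)) <= _); last first.
    by rewrite sumr_const card_ord -[leLHS]mulr_natl le_eqVlt; apply/orP; left; apply/eqP; ring.
  rewrite big_mkcond; apply: ler_sum => i _; case: ifP => [hi|_]; last first.
    by rewrite mulr_ge0 ?expR_ge0.
  rewrite cabsM cabs_real ger0_norm ?one_sub_tanh2_ge0 //.
  apply: le_trans (_ : 1 - tanh (D i / delta) ^+ 2 <= _).
    by rewrite ler_piMl ?one_sub_tanh2_ge0.
  apply: le_trans (one_sub_tanh2_le _) _; rewrite ler_pM2l // ler_expR lerN2.
  rewrite normrM [`|delta^-1|]gtr0_norm ?invr_gt0 // mulrA ler_pM2r ?invr_gt0 //.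
  by have := highE i hi; lra.
apply: le_trans (ler_cabs_sum _ _ _) _.
apply: le_trans (_ : \sum_(i < n) e / delta <= _); last first.
  by rewrite sumr_const card_ord -[leLHS]mulr_natl mulrA.
rewrite big_mkcond; apply: ler_sum => i _; case: ifP => [li|_]; last first.
  by rewrite divr_ge0 // ltW.
rewrite cabsM cabs_real ger0_norm ?sqr_ge0 //.
apply: le_trans (_ : cabs (X i i) * (2 * `|D i / delta|) <= _).
  by rewrite ler_wpM2l ?cabs_ge0 ?tanh2_le.
rewrite normrM [`|delta^-1|]gtr0_norm ?invr_gt0 // !mulrA ler_pM2r ?invr_gt0 //.
have := X_anticomm i (lowE i li); have -> : D i + D i = 2 * D i by ring.
rewrite normrM ger0_norm //.
by rewrite mulrA.
Qed.

End LowEnergyTrace.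

(** * Numerical error bounds *)

Section ErrorBound.
Context {R : realType}.
Variables (d K Delta : R) (L : nat).
Hypotheses (d0 : 0 < d) (K0 : 0 < K) (Delta0 : 0 < Delta) (L0 : (0 < L)%N).
Let delta := Num.sqrt (128 * Delta * d * K / L%:R).

Let e := 16 * (d * K) ^+ 2 / Delta * expR (- (Delta / (8 * d * K) * (L./2)%:R)).

Lemma delta_gt0 : 0 < delta.
Proof. by rewrite sqrtr_gt0 divr_gt0 ?ltr0n // !mulr_gt0. Qed.

Lemma decay_exponent : Num.sqrt (L%:R * Delta / (128 * d * K)) = Delta / delta.
Proof.
have t0 : 0 <= Delta / delta by rewrite divr_ge0 ?ltW ?delta_gt0.
rewrite -[RHS]ger0_norm // -sqrtr_sqr; congr Num.sqrt.
rewrite expr_div_n sqr_sqrtr; last by rewrite divr_ge0 // !mulr_ge0 ?ltW.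
by field; rewrite !gt_eqF // ltr0n.
Qed.

(** In this regime the exponential is at least 1/4, so the bound exceeds the dimension 2 L, a
    trivial bound on the index. *)
Lemma trivial_error_bound : Delta / delta < 1 ->
  (L * 2)%:R <= 800 * L%:R ^+ 8 * expR (- (Delta / delta)).
Proof.
move=> t1; have L1 : 1 <= (L%:R : R) by rewrite ler1n.
have LL8 : (L%:R : R) <= L%:R ^+ 8 by rewrite -[leLHS]expr1 ler_weXn2l.
have e4 : 1 / 4 <= expR (- (Delta / delta)).
  have -> : - (Delta / delta) = - (Delta / delta) / 2 + - (Delta / delta) / 2.
    by field; rewrite gt_eqF ?delta_gt0.
  rewrite expRD; have := expR_ge1Dx (- (Delta / delta) / 2) => h1.
  set z := expR _ in h1 *; have z2 : 1 / 2 <= z by lra.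
  by nra.
rewrite natrM; apply: le_trans (_ : 800 * L%:R ^+ 8 * (1 / 4) <= _); first by lra.
by apply: ler_wpM2l e4; apply: mulr_ge0; [exact: ler0n|apply: exprn_ge0; exact: ler0n].
Qed.

Lemma commutator_error_bound : (1 < L)%N -> 1 <= Delta / delta ->
  e / Delta <= L%:R ^+ 2 * expR (- (5 * (Delta / delta) ^+ 2)).
Proof.
move=> L2 t1; set t := Delta / delta in t1 *.
(* All quantities are expressed by this ratio and t, with L = 128 a t^2. Then t >= 1 gives a <= L /
   128, and L <= 3 [L./2], valid from L = 2 on, makes the exponent at least 128 t^2 / 24 >= 5
   t^2. *)
pose a := d * K / Delta; have a0 : 0 < a by rewrite divr_gt0 ?mulr_gt0.
have Lat : L%:R = 128 * a * t ^+ 2.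
  rewrite /t expr_div_n sqr_sqrtr; last by rewrite divr_ge0 // !mulr_ge0 ?ltW.
  by rewrite /a; field; rewrite !gt_eqF // ltr0n.
have t2 : 1 <= t ^+ 2 by rewrite -[leLHS](expr1n R 2) lerXn2r ?nnegrE //; lra.
have aL : a <= L%:R / 128 by rewrite Lat; nra.
have -> : e / Delta = 16 * a ^+ 2 * expR (- ((L./2)%:R / (8 * a))).
  rewrite /e /a; have -> : Delta / (8 * d * K) * (L./2)%:R = (L./2)%:R / (8 * (d * K / Delta)).
    by field; rewrite !gt_eqF.
  by field; rewrite !gt_eqF.
clearbody a; apply: ler_pM; rewrite ?expR_ge0 ?mulr_ge0 ?sqr_ge0 ?(ltW a0) //.
  apply: le_trans (_ : 16 * (L%:R / 128) ^+ 2 <= _).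
    by rewrite ler_pM2l // lerXn2r ?nnegrE ?divr_ge0 ?(ltW a0).
  by have := sqr_ge0 (L%:R : R); rewrite expr_div_n; lra.
rewrite ler_expR lerN2 ler_pdivlMr ?mulr_gt0 //.
have : (L%:R : R) <= 3 * (L./2)%:R by rewrite -natrM ler_nat; lia.
have : 0 <= a * t ^+ 2 by rewrite mulr_ge0 ?sqr_ge0 ?(ltW a0).
by rewrite Lat; lra.
Qed.

(** The surplus in exp(-5 t^2) absorbs the factor t coming from 1 / delta = t / Delta. After raising
    all powers of L to the eighth, the coefficients add up to 8 + 2 + 512 + 256 = 778. *)
Lemma total_error_bound : (1 < L)%N -> 1 <= Delta / delta ->
  4 * (L * 2)%:R * expR (- (Delta / delta)) + (L * 2)%:R * e / delta
    + 8 * (L * 2)%:R ^+ 5 * (L * 2).+1%:R * e / Delta <=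
  800 * L%:R ^+ 8 * expR (- (Delta / delta)).
Proof.
move=> L2 t1; have eD := commutator_error_bound L2 t1.
set t := Delta / delta in t1 eD *.
pose l : R := L%:R; have l1 : 1 <= l by rewrite ler1n.
have q0 : 0 < expR (- t) by apply: expR_gt0.
have e1 : t * expR (- (5 * t ^+ 2)) <= expR (- t).
  apply: le_trans (_ : expR t * expR (- (5 * t ^+ 2)) <= _).
    by rewrite ler_wpM2r ?expR_ge0 //; have := expR_ge1Dx t; lra.
  by rewrite -expRD ler_expR; nra.
have eD' : e / Delta <= l ^+ 2 * expR (- t).
  apply: le_trans eD _; rewrite ler_wpM2l ?sqr_ge0 // ler_expR; nra.
have ed : e / delta <= l ^+ 2 * expR (- t).
  have -> : e / delta = t * (e / Delta) by rewrite /t; field; rewrite !gt_eqF ?delta_gt0.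
  apply: le_trans (_ : t * (l ^+ 2 * expR (- (5 * t ^+ 2))) <= _).
    by rewrite ler_wpM2l //; lra.
  by rewrite mulrCA ler_wpM2l ?sqr_ge0.
rewrite -natr1 natrM -/l -[_ * e / delta]mulrA -[_ * e / Delta]mulrA.
move: eD' ed; set x := e / delta; set y := e / Delta; set q := expR (- t) in q0 *.
move=> yq xq.
have pw k : (k <= 8)%N -> l ^+ k <= l ^+ 8 by move=> k8; rewrite ler_weXn2l.
have h1 : l * 2 * x <= l * 2 * (l ^+ 2 * q).
  by rewrite ler_wpM2l // mulr_ge0 //; lra.
have h2 : (l * 2) ^+ 5 * (l * 2 + 1) * y <=
    (l * 2) ^+ 5 * (l * 2 + 1) * (l ^+ 2 * q).
  by rewrite ler_wpM2l // mulr_ge0 ?exprn_ge0 //; lra.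
have p1 : l * q <= l ^+ 8 * q by rewrite ler_pM2r // -[leLHS]expr1 pw.
have p3 : l ^+ 3 * q <= l ^+ 8 * q by rewrite ler_pM2r // pw.
have p7 : l ^+ 7 * q <= l ^+ 8 * q by rewrite ler_pM2r // pw.
have p8 : 0 <= l ^+ 8 * q by rewrite mulr_ge0 ?exprn_ge0 ?(ltW q0) //; lra.
lra.
Qed.

End ErrorBound.

(** * The chiral and switch operators on the chain *)

Section ChiralChain.
Context {R : realType}.
Variable L : nat.
Local Notation RtoC := (real_complex R).
Local Notation C := (chiralL R L).
Local Notation Th := (thetaX R L).

Lemma chiralL_sqr : C *m C = 1%:M.
Proof.
rewrite /chiralL mulmx_diag; apply/matrixP => i j; rewrite !mxE.
by case: (spin i == ord0); rewrite ?mulrNN mulr1.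
Qed.

Lemma mxstar_chiralL : mxstar C = C.
Proof.
apply/matrixP => i j; rewrite mxstarE !mxE.
have [->|_] := eqVneq i j; last by rewrite !mulr0n conjc0.
rewrite !mulr1n; case: (spin j == ord0); first exact: conjc1.
by rewrite rmorphN; congr (- _); exact: conjc1.
Qed.

Lemma thetaX_sqr : Th *m Th = Th.
Proof.
rewrite /thetaX mulmx_diag; congr diag_mx; apply/rowP => i; rewrite !mxE /theta.
by case: ifP; rewrite ?mulr0 ?mulr1.
Qed.

Lemma mxstar_thetaX : mxstar Th = Th.
Proof.
apply/matrixP => i j; rewrite mxstarE !mxE.
have [->|_] := eqVneq i j; last by rewrite !mulr0n conjc0.
by rewrite !mulr1n /theta; case: ifP; rewrite ?conjc1 ?conjc0.
Qed.

Lemma chiralL_thetaX : C *m Th = Th *m C.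
Proof. exact: diag_mxC. Qed.

Lemma vnorm2_chiralL v : vnorm2 (C *m v) = vnorm2 v.
Proof. by apply: vnorm2_unitary; rewrite mxstar_chiralL chiralL_sqr. Qed.

Lemma vnorm2_thetaX v : vnorm2 (Th *m v) <= vnorm2 v.
Proof.
apply: ler_sum => i _; rewrite /thetaX mul_diag_mx !mxE /theta.
by case: ifP; rewrite ?mul1r // mul0r -sqr_cabs cabs0 expr0n cabs2_ge0.
Qed.

(** The switch does not see the spin, so the two spins of each site cancel. *)
Lemma mxtrace_chiralL_thetaX : \tr (C *m Th) = 0.
Proof.
rewrite /chiralL /thetaX mulmx_diag mxtrace_diag.
under eq_bigr do rewrite !mxE.
rewrite (sum_site_spin L (fun n a => (if a == ord0 then 1 else -1) * theta R L n)).
rewrite big1 // => n _.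
by rewrite big_ord_recl big_ord1 /= mul1r mulN1r subrr.
Qed.

Lemma chain_restrict_chiral (h : bulk_kernel R) : bulk_chiral h ->
  C *m chain_restrict h L = - (chain_restrict h L *m C).
Proof.
move=> hC; apply/eqP; rewrite -addr_eq0; apply/eqP/matrixP => i j.
rewrite /chiralL mul_diag_mx mul_mx_diag !mxE.
have /matrixP/(_ (spin i) (spin j)) := hC (site i)%:Z (site j)%:Z.
by rewrite /chiral2 mul_diag_mx mul_mx_diag !mxE.
Qed.

End ChiralChain.

(** * The two indices in an eigenbasis of H *)

Section EigenbasisIndex.
Context {R : realType}.
Local Notation RtoC := (real_complex R).
Variables (L : nat) (H S U : 'M[R[i]]_(L * 2)) (D : 'rV[R]_(L * 2)) (f : R -> R).
Local Notation C := (chiralL R L).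
Local Notation Th := (thetaX R L).
Local Notation diagR E := (diag_mx (map_mx RtoC E)).
Local Notation e_ j := (delta_mx j ord0 : 'cV[R[i]]_(L * 2)).
Hypotheses (UU : U *m mxstar U = 1%:M) (HC : C *m H = - (H *m C)).
Hypothesis HE : H = U *m diagR D *m mxstar U.
Hypothesis SE : S = U *m diagR (map_mx f D) *m mxstar U.

Definition eigenbasis_index : 'M[R[i]]_(L * 2) := mxstar U *m (C *m Th) *m U.
Local Notation X := eigenbasis_index.

Let UU' : mxstar U *m U = 1%:M. Proof. exact: mulmx1C. Qed.

Let mxstarUK m (A : 'M[R[i]]_(L * 2, m)) : U *m (mxstar U *m A) = A.
Proof. by rewrite mulmxA UU mul1mx. Qed.

Lemma eigenbasis_index_herm : mxstar X = X.
Proof.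
by rewrite /eigenbasis_index !mxstarM mxstarK mxstar_thetaX mxstar_chiralL -chiralL_thetaX !mulmxA.
Qed.

(** C and Th commute, C^2 = 1 and Th^2 = Th, hence (C Th)^2 = Th and (C Th)^3 = C Th. *)
Lemma eigenbasis_index_cube : X *m X *m X = X.
Proof.
rewrite /eigenbasis_index -!mulmxA !mxstarUK !mulmxA; congr (_ *m _).
rewrite -!mulmxA; congr (_ *m _).
by rewrite !mulmxA -(mulmxA C Th C) -chiralL_thetaX mulmxA chiralL_sqr mul1mx
  thetaX_sqr -chiralL_thetaX -mulmxA thetaX_sqr.
Qed.

Lemma eigenbasis_index_le1 i j : cabs (X i j) <= 1.
Proof.
rewrite -sqrtr1 /cabs ler_wsqrtr //.
have := cabs2_le_vnorm2 (X *m delta_mx j ord0) i; rewrite -colE mxE => /le_trans; apply.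
rewrite colE /eigenbasis_index -!mulmxA vnorm2_unitary ?mxstarK // vnorm2_chiralL.
apply: le_trans (vnorm2_thetaX _) _.
by rewrite vnorm2_unitary // vnorm2_delta.
Qed.

Lemma eigenbasis_eigenvector j :
  H *m (U *m e_ j) = RtoC (D ord0 j) *: (U *m e_ j).
Proof.
rewrite HE -!mulmxA (mulmxA (mxstar U)) UU' mul1mx scalemxAr; congr (_ *m _).
apply/colP => i; rewrite mul_diag_mx !mxE.
by case: eqP => [->|_] //=; rewrite !mulr0.
Qed.

(* [C [Th, H] = (C Th) H + H (C Th)], because [C] anticommutes with [H]. *)
Lemma eigenbasis_index_anticomm i j (e : R) : 0 <= e ->
  vnorm2 ((Th *m H - H *m Th) *m (U *m e_ j)) <= e ^+ 2 ->
  cabs (X i j) * `|D ord0 i + D ord0 j| <= e.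
Proof.
move=> e0 comm_le.
pose M := mxstar U *m (C *m (Th *m H - H *m Th)) *m U.
have ME : M = X *m diagR D + diagR D *m X.
  have UH : mxstar U *m H = diagR D *m mxstar U.
    by rewrite HE !mulmxA UU' mul1mx.
  have HU : H *m U = U *m diagR D by rewrite HE -!mulmxA UU' mulmx1.
  rewrite /M mulmxBr (mulmxA C H) HC mulNmx opprK mulmxDr mulmxDl; congr (_ + _).
    by rewrite /eigenbasis_index -!mulmxA HU.
  by rewrite !mulmxA UH -!mulmxA.
have -> : cabs (X i j) * `|D ord0 i + D ord0 j| = cabs (M i j).
  rewrite ME mul_diag_mx mul_mx_diag !mxE [RtoC _ * _]mulrC -mulrDr cabsM.
  by rewrite -rmorphD cabs_real addrC.
rewrite -[e]ger0_norm // -sqrtr_sqr /cabs ler_wsqrtr //; apply: le_trans comm_le.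
have := cabs2_le_vnorm2 (M *m delta_mx j ord0) i; rewrite -colE mxE => /le_trans; apply.
by rewrite colE /M -!mulmxA vnorm2_unitary ?mxstarK // vnorm2_chiralL.
Qed.

Lemma edge_index_eigenbasis : \tr (C *m Th *m (1%:M - S *m S)) =
  \sum_i X i i * RtoC (1 - f (D ord0 i) ^+ 2).
Proof.
have -> : 1%:M - S *m S =
    U *m diag_mx (\row_i RtoC (1 - f (D ord0 i) ^+ 2)) *m mxstar U.
  have -> : S *m S = U *m (diagR (map_mx f D) *m diagR (map_mx f D)) *m mxstar U.
    by rewrite SE -!mulmxA (mulmxA (mxstar U) U) UU' mul1mx.
  rewrite -{1}UU -{1}[U]mulmx1 -mulmxBl -mulmxBr mulmx_diag; congr (_ *m _ *m _).
  apply/matrixP => i j; rewrite !mxE.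
  have [->|_] := eqVneq i j; last by rewrite !mulr0n subr0.
  by rewrite !mulr1n -rmorphM rmorphB rmorph1.
rewrite mulmxA mxtrace_mulC.
rewrite (_ : mxstar U *m _ = X *m diag_mx (\row_i RtoC (1 - f (D ord0 i) ^+ 2))).
  by apply: eq_bigr => i _; rewrite mul_mx_diag !mxE.
by rewrite /eigenbasis_index -!mulmxA.
Qed.

(** An odd function of H anticommutes with C, as H does. Cyclicity of the trace then gives both
    sides the value -Tr(C Th S^2), since Tr(C Th) = 0. *)
Lemma bulk_index_eq_edge_index : (forall t, f (- t) = - f t) ->
  2^-1 * \tr (C *m S *m (Th *m S - S *m Th)) = \tr (C *m Th *m (1%:M - S *m S)).
Proof.
move=> f_odd.
pose Q := mxstar U *m C *m U.
have QD : Q *m diagR D = - (diagR D *m Q).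
  have := congr1 (fun A => mxstar U *m A *m U) HC.
  rewrite HE mulmxN mulNmx !mulmxA UU' mul1mx -!mulmxA UU' mulmx1 => ->.
  by rewrite /Q !mulmxA.
have CE : C = U *m Q *m mxstar U by rewrite /Q -!mulmxA UU mulmx1 mxstarUK.
clearbody Q.
(* Entrywise, [QD] says that a nonzero Q_ij forces D_j = -D_i, where oddness of [f] applies. *)
have QF : Q *m diagR (map_mx f D) = - (diagR (map_mx f D) *m Q).
  apply/matrixP => i j; move/matrixP/(_ i j): QD.
  rewrite !mul_mx_diag !mul_diag_mx !mxE => QDij.
  have [->|Qij] := eqVneq (Q i j) 0; first by rewrite mulr0 mul0r oppr0.
  have DjE : D ord0 j = - D ord0 i.
    apply: (complexI (R := R)); apply: (mulfI Qij); rewrite QDij.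
    by rewrite rmorphN mulrN mulrC.
  by rewrite DjE f_odd rmorphN mulrN mulrC.
have SC : S *m C = - (C *m S).
  have -> : S *m C = U *m (diagR (map_mx f D) *m Q) *m mxstar U.
    by rewrite {1}CE SE -!mulmxA (mulmxA (mxstar U) U) UU' mul1mx.
  have -> : C *m S = U *m (Q *m diagR (map_mx f D)) *m mxstar U.
    by rewrite {1}CE SE -!mulmxA (mulmxA (mxstar U) U) UU' mul1mx.
  by rewrite QF mulmxN mulNmx opprK.
rewrite !mulmxBr mulmx1 !linearB /= mxtrace_chiralL_thetaX sub0r.
have -> : \tr (C *m S *m (Th *m S)) = - \tr (C *m Th *m (S *m S)).
  rewrite mulmxA mxtrace_mulC !mulmxA SC !mulNmx linearN /=; congr (- _).
  by rewrite mxtrace_mulC !mulmxA -chiralL_thetaX.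
have -> : \tr (C *m S *m (S *m Th)) = \tr (C *m Th *m (S *m S)).
  by rewrite !mulmxA mxtrace_mulC !mulmxA -chiralL_thetaX.
by field.
Qed.

End EigenbasisIndex.

(** * The uniform polynomial bound and the conclusion *)

Lemma monomial_polynomial (R : realType) n (c : R) (j : 'I_n) (k : nat) :
  exists P : mpoly.mpoly n R, forall v, mpoly.meval v P = c * v j ^+ k.
Proof.
pose m := mpoly.Multinom [tuple if i == j then k else 0%N | i < n].
have mE i : mpoly.fun_of_multinom m i = if i == j then k else 0%N.
  by rewrite mpoly.multinomE tnth_mktuple.
have mevalm v : mpoly.meval v (mpoly.mpolyX R m) = v j ^+ k.
  rewrite mpoly.mevalX (bigD1 j) //= mE eqxx big1 ?mulr1 // => i /negbTE ij.
  by rewrite mE ij expr0.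
by eexists => v; rewrite -mevalm; exact: mpoly.mevalZ.
Qed.

Lemma edge_index_near_integer (R : realType) (h : bulk_kernel R) (d K Delta : R) (L : nat)
    (U : 'M[R[i]]_(L * 2)) (D : 'rV[R]_(L * 2)) :
  let delta := Num.sqrt (128 * Delta * d * K / L%:R) in
  0 < d -> 0 < K -> 0 < Delta -> (0 < L)%N ->
  bulk_selfadjoint h -> bulk_chiral h -> short_range h d K -> bulk_gap h Delta ->
  U *m mxstar U = 1%:M ->
  chain_restrict h L = U *m diag_mx (map_mx (real_complex R) D) *m mxstar U ->
  exists k : int,
    cabs (\sum_i eigenbasis_index U i i *
            real_complex R (1 - tanh (D ord0 i / delta) ^+ 2) - k%:~R) <=
    800 * L%:R ^+ 8 * expR (- (Delta / delta)).
Proof.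
move=> delta d0 K0 Delta0 L0 sa hC sr gap UU HE.
have UU' := mulmx1C UU.
have delta0 : 0 < delta by apply: delta_gt0.
have [t1|t1] := ltP (Delta / delta) 1.
  exists 0; rewrite subr0; apply: le_trans (trivial_error_bound d0 K0 Delta0 L0 t1).
  apply: le_trans (ler_cabs_sum _ _ _) _.
  apply: le_trans (_ : \sum_(i < L * 2) 1 <= _); last by rewrite sumr_const card_ord.
  apply: ler_sum => i _; rewrite cabsM cabs_real ger0_norm ?one_sub_tanh2_ge0 //.
  rewrite -[leRHS]mulr1; apply: ler_pM;
    rewrite ?cabs_ge0 ?one_sub_tanh2_ge0 ?eigenbasis_index_le1 //.
  by rewrite lerBlDr lerDl sqr_ge0.
(* For L = 1 the jump [L./2] is 0, so the switch function and the whole sum vanish. *)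
have [L2|L1] := ltnP 1 L; last first.
  exists 0; rewrite subr0 big1 => [|i _].
    rewrite cabs0; apply: mulr_ge0; last exact: expR_ge0.
    by apply: mulr_ge0; [exact: ler0n|apply: exprn_ge0; exact: ler0n].
  rewrite /eigenbasis_index (_ : thetaX R L = 0) ?mulmx0 ?mul0mx ?mxE ?mul0r //.
  apply/matrixP => a b; rewrite !mxE /theta ifF ?mul0rn //.
  by have -> : L./2 = 0%N by lia.
pose e := 16 * (d * K) ^+ 2 / Delta * expR (- (Delta / (8 * d * K) * (L./2)%:R)).
have e0 : 0 <= e.
  by rewrite mulr_ge0 ?expR_ge0 // divr_ge0 ?(ltW Delta0) // mulr_ge0 ?sqr_ge0.
have HC := chain_restrict_chiral L hC.
have anticomm i j : `|D ord0 j| <= 3 / 4 * Delta ->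
    cabs (eigenbasis_index U i j) * `|D ord0 i + D ord0 j| <= e.
  move=> lowj; apply: (eigenbasis_index_anticomm UU HC HE) => //.
  apply: (chain_commutator_decay d0 K0 Delta0 sa sr gap lowj).
    by rewrite vnorm2_unitary // vnorm2_delta.
  exact: (eigenbasis_eigenvector UU HE).
have [k kP] := index_near_integer (D := fun i => D ord0 i) e0 delta0 Delta0
  (eigenbasis_index_herm U) (eigenbasis_index_cube UU)
  (eigenbasis_index_le1 UU) anticomm.
exists k; apply: le_trans kP _.
exact: (total_error_bound d0 K0 Delta0 L0 L2 t1).
Qed.

Unset Implicit Arguments.

Theorem theorem1 (R : realType) :
  exists P : mpoly.mpoly 3 R,
  forall (h : bulk_kernel R) (d K Delta : R) (L : nat),
    0 < d -> 0 < K -> 0 < Delta -> (0 < L)%N ->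
    bulk_selfadjoint h -> bulk_bounded h -> bulk_chiral h ->
    short_range h d K -> bulk_gap h Delta ->
    let delta := Num.sqrt (128 * Delta * d * K / L%:R) in
    forall S : 'M[R[i]]_(L * 2),
      mx_fcalc (fun t => tanh (t / delta)) (chain_restrict h L) S ->
      let C := chiralL R L in
      let Th := thetaX R L in
      let Ibulk := 2^-1 * \tr (C *m S *m (Th *m S - S *m Th)) in
      let Iedge := \tr (C *m Th *m (1%:M - S *m S)) in
      let bound := mpoly.meval (pt3 K d L%:R) P *
                   expR (- Num.sqrt (L%:R * Delta / (128 * d * K))) in
      (exists n : int, cabs (Ibulk - n%:~R) <= bound) /\
      (exists n : int, cabs (Iedge - n%:~R) <= bound).
Proof.
(* The polynomial is 800 times the eighth power of the variable of index 2, at which [pt3] places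
   L. *)
have [P PE] := monomial_polynomial (800 : R) (@Ordinal 3 2 isT) 8.
exists P.
move=> h d K Delta L d0 K0 Delta0 L0 sa _ hC sr gap delta S [U [D [UU [HE SE]]]].
move=> C Th Ibulk Iedge bound.
pose f (t : R) := tanh (t / delta).
have boundE : bound = 800 * L%:R ^+ 8 * expR (- (Delta / delta)).
  by rewrite /bound decay_exponent // PE.
have SE' : S = U *m diag_mx (map_mx (real_complex R) (map_mx f D)) *m mxstar U.
  by rewrite SE; congr (_ *m diag_mx _ *m _); apply/rowP => i; rewrite !mxE.
have HC : C *m chain_restrict h L = - (chain_restrict h L *m C).
  exact: chain_restrict_chiral.
have f_odd t : f (- t) = - f t by rewrite /f mulNr tanhN.
have -> : Ibulk = Iedge by exact: (bulk_index_eq_edge_index UU HC HE SE' f_odd).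
suff edge : exists n : int, cabs (Iedge - n%:~R) <= bound by split.
rewrite boundE /Iedge (edge_index_eigenbasis UU SE').
exact: (edge_index_near_integer d0 K0 Delta0 L0 sa hC sr gap UU HE).
Qed.
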